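(* Suppose that Assumptions A and B of the context hold. Let $r\in(0,1)$ and $\mu_0>0$, and let $\mu_k=\mu_0(k+1)^{-r}$ for all $k\in\mathbb N$. Let $\{x^k\}$ be generated by the algorithm sMBA described in the context (with this $\{\mu_k\}$). Let $\epsilon_1>0$ and $\epsilon_2>0$. With $\psi^*$ the optimal value of problem (P) and the constants $M_\lambda,\bar M_1,\bar M_2$ defined in the context, suppose that $K\in\mathbb N_0$ satisfies $$K\ge\max\left\{\left(\frac{\bar M_1(\psi(x^0)-\psi^* )2^{2r+1}}{\mu_0}\right)^{\frac1{1-r}}\epsilon_1^{-\frac2{1-r}},\ \ 2\mu_0^{\frac1r}\min\left\{\frac{\bar M_1}{\alpha_3\bar M_1M_\lambda+\bar M_2\epsilon_1^2},\frac{\tau_1\bar M_1}{2}\right\}^{-\frac1r}\epsilon_2^{-\frac1r}\right\}.$$ Then there exists an integer $\hat k\in[\lceil K/2\rceil,K]$ such that $x^{\hat k+1}$ is an $(\epsilon_1,\epsilon_2,\epsilon_1\sqrt{\epsilon_2})$-KKT point of problem (P).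
   Context: **Notation.** $\mathbb X,\mathbb Y$ are finite-dimensional real Hilbert spaces; $\mathbb N_0=\mathbb N\cup\{0\}$ with $\mathbb N=\{1,2,\dots\}$; $B(x,r)$ is the closed ball. For a cone $\mathcal K\subseteq\mathbb Y$, $\mathcal K^\circ=\{y:\langle y,w\rangle\le0\ \forall w\in\mathcal K\}$. A map is $L$-smooth if it is continuously differentiable with $L$-Lipschitz derivative; $DG(x)$ is the derivative of $G$, $DG(x)^*$ its adjoint, $\|DG(x)\|$ its operator norm. $\partial$ is the convex subdifferential. $\sigma_{\mathcal C}(y)=\sup_{u\in\mathcal C}\langle y,u\rangle$ is the support function. A base of a cone $\mathcal Q$ is a convex set $\mathcal D$ with $0\notin\mathrm{cl}(\mathcal D)$ and $\mathcal Q=\bigcup_{t\ge0}t\mathcal D$. **Problem (P).** Minimize $\psi(x):=f(x)+P_1(x)-P_2(x)$ over $x\in\mathbb X$ subject to $G(x)\in\mathcal K$. **Approximate KKT points.** For $\epsilon_1,\epsilon_2,\epsilon_3\ge0$, $x\in G^{-1}(\mathcal K)$ is an $(\epsilon_1,\epsilon_2,\epsilon_3)$-KKT point of (P) if there exist $z\in G^{-1}(\mathcal K)$ and $v\in\mathcal K^\circ$ such that $\mathrm{dist}(0,\partial P_1(x)-\partial P_2(z)+\nabla f(x)+DG(x)^*v)\le\epsilon_1$, $-\langle v,G(x)\rangle\le\epsilon_2$ and $\|x-z\|\le\epsilon_3$. **Assumption A.** (i) $\mathcal K\subseteq\mathbb Y$ is a closed convex pointed cone with nonempty interior. (ii) $f:\mathbb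 X\to\mathbb R$ is $L_f$-smooth and $G:\mathbb X\to\mathbb Y$ is $L_G$-smooth, $L_f>0$, $L_G\ge0$. (iii) $P_1,P_2:\mathbb X\to\mathbb R$ are convex. (iv) There is $x^0\in\mathbb X$ with $G(x^0)\in\mathrm{int}(\mathcal K)$ such that $\Omega_0:=\{x:\psi(x)\le\psi(x^0),\ G(x)\in\mathcal K\}$ is bounded. (v) (Robinson's constraint qualification) $0\in\mathrm{int}(G(x)+DG(x)\mathbb X-\mathcal K)$ for all $x\in\Omega_0$. $\mathcal B$ is a fixed compact base of $\mathcal K^\circ$ (one exists), and $g_{\mathcal B}(x):=\sigma_{\mathcal B}(G(x))$. **Assumption B.** There are $\alpha_1\ge0$, $\alpha_2,\alpha_3,\alpha_4>0$ and a family $\{h_\mu\}_{\mu>0}$ of convex $C^1$ functions on $\mathbb Y$ such that for every $\mu>0$, $\nabla h_\mu$ is $(\alpha_1+\alpha_2/\mu)$-Lipschitz and $\sigma_{\mathcal B}(y)\le h_\mu(y)\le\sigma_{\mathcal B}(y)+\alpha_3\mu$ for all $y\in\mathbb Y$; and $h_{\mu_1}(y)\le h_{\mu_0}(y)-\alpha_4(\mu_0-\mu_1)$ for all $y\in\mathbb Y$ and $\mu_0>\mu_1>0$. Put $g_\mu(x):=h_\mu(G(x))$. **Algorithm sMBA.** Input: $\tau_1,\tau_2>0$, $\hat L\ge\check L>0$, the point $x^0$ of Assumption A(iv), the family $\{h_\mu\}$. Step 1: find $\mu_0>0$ with $g_{\mu_0}(x^0)<0$; set $k=0$. Step 2: choose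 $\xi^k\in\partial P_2(x^k)$ and $L_f^{k,0},L_g^{k,0}\in[\check L,\hat L]$; set $i=j=0$. Step 3: set $L_f^{k,i}=2^iL_f^{k,0}$, $L_g^{k,j}=2^jL_g^{k,0}$; let $x^{k,i,j}$ be the unique solution, and $\lambda_{k,i,j}\ge0$ a Lagrange multiplier, of the problem of minimizing $\psi_{k,i}(x):=P_1(x)+\langle\nabla f(x^k)-\xi^k,x-x^k\rangle+\frac{L_f^{k,i}}2\|x-x^k\|^2$ subject to $g_{k,j}(x):=g_{\mu_k}(x^k)+\langle\nabla g_{\mu_k}(x^k),x-x^k\rangle+\frac{L_g^{k,j}}{2\mu_k}\|x-x^k\|^2\le0$. Step 4: if $g_{\mu_k}(x^{k,i,j})\le0$ and $\psi(x^{k,i,j})\le\psi(x^k)-\frac{\tau_1\mu_k+\tau_2\lambda_{k,i,j}}{2\mu_k}\|x^{k,i,j}-x^k\|^2$, set $i_k=i$, $j_k=j$ and go to Step 5; else if $g_{\mu_k}(x^{k,i,j})>0$, set $j\leftarrow j+1$ and go to Step 3; else set $i\leftarrow i+1$, $j\leftarrow j+1$ and go to Step 3. Step 5: set $x^{k+1}=x^{k,i_k,j_k}$, $\lambda_{k+1}=\lambda_{k,i_k,j_k}$, $L_f^k=L_f^{k,i_k}$, $L_g^k=L_g^{k,j_k}$; choose $\mu_{k+1}\in(0,\mu_k)$; $k\leftarrow k+1$; go to Step 2. **Constants.** $M_{\mathcal B}=\sup_{u\in\mathcal B}\|u\|$; $M_G=\sup_{x\in\Omega_0}\|DG(x)\|$;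 $g^*_{\mathcal B}=\inf_{x\in\Omega_0}g_{\mathcal B}(x)$; $M_R=\sqrt{\mu_0^2\check L^{-2}M_G^2M_{\mathcal B}^2-2\mu_0\check L^{-1}g^*_{\mathcal B}}+\mu_0\check L^{-1}M_GM_{\mathcal B}$; $\hat\Omega_0=\Omega_0+B(0,M_R)$; $\hat M_G=\sup\{\|DG(x)\|:x\in\mathrm{conv}(\hat\Omega_0)\}$; $L_\mu=M_{\mathcal B}L_G+\alpha_1\hat M_G^2+\alpha_2\hat M_G^2/\mu$; $M_L=\hat L\max\{2,2(L_f+\tau_1)/\check L\}\max\{2,2\tau_2/\check L,2\mu_0L_{\mu_0}/\check L\}$. $M_f=\sup_{x\in\Omega_0}\|\nabla f(x)\|$; $M_{P_1}=\sup_{x\in\hat\Omega_0}\{\|\zeta\|:\zeta\in\partial P_1(x)\}$; $M_{P_2}=\sup_{x\in\Omega_0}\{\|\xi\|:\xi\in\partial P_2(x)\}$. $\eta>0$ is a constant (one exists) such that for no $(x,u)\in\Omega_0\times\mathcal B$ do both $\|DG(x)^*u\|^2\le\eta$ and $-\langle u,G(x)\rangle\le\eta$ hold. $\bar t$ is the first positive integer with $\mu_{\bar t}<\eta/(2\alpha_3)$; $c_0=\min\{\mu_{t-1}/\mu_t-1:t=1,\dots,\bar t\}$; $\bar\eta=\sqrt{\min\{\eta,\,2\alpha_3\check L,\,-2\mu_0^{-1}\check Lg_{\mu_0}(x^0),\,2c_0\alpha_4\check L\}}$; $M_\lambda=\frac{M_f+M_{P_1}+M_{P_2}}{\bar\eta}+\frac{M_LM_G^2M_{\mathcal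 B}^2\mu_0}{2\check L\bar\eta^2}$; $\bar M_1=16M_L^2\max\{\mu_0/\tau_1,M_\lambda/\tau_2\}$; $\bar M_2=(M_L+\mu_0L_GM_{\mathcal B})/\tau_2$. *)

(* Defs.v *)
From HB Require Import structures.
From mathcomp Require Import all_boot all_order all_algebra.
From mathcomp Require Import sesquilinear.
From mathcomp Require Import all_classical all_reals all_analysis.

Set Implicit Arguments.
Unset Strict Implicit.
Unset Printing Implicit Defensive.

Import Order.TTheory GRing.Theory Num.Theory.
Import numFieldNormedType.Exports.

Local Open Scope classical_set_scope.
Local Open Scope ring_scope.

(* Finite-dimensional real Hilbert spaces: the topology and the differential
   calculus are those of the norm, which [dotp_norm] forces to be the one
   induced by the inner product. *)
HB.mixin Record NormedModule_isHilbert (R : realType) V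
    of GRing.Lmodule R V & NormedModule R V := {
  dotp : {dot V for (idfun : R -> R)} ;
  dotp_norm : forall v : V, dotp v v = `|v| ^+ 2
}.

#[short(type="finHilbertType")]
HB.structure Definition FinHilbert (R : realType) :=
  {V of Vector R V & NormedModule R V & NormedModule_isHilbert R V}.

Notation "''[' u , v ]" := (dotp u v) : ring_scope.

Section Calculus.
Context {R : realType}.

Definition opnorm (V W : normedModType R) (A : V -> W) : R :=
  sup [set `|A v| | v in [set v : V | `|v| <= 1]].

Definition C1 (V W : normedModType R) (F : V -> W) : Prop :=
  (forall x, differentiable F x) /\
  (forall x, opnorm (fun v => 'd F y v - 'd F x v) @[y --> x] --> (0 : R)).

Definition smooth (L : R) (V W : normedModType R) (F : V -> W) : Prop :=
  C1 F /\
  (forall x y, opnorm (fun v => 'd F x v - 'd F y v) <= L * `|x - y|).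

(* The vector representing the linear form [l]; 0 if there is none. *)
Definition riesz (V : finHilbertType R) (l : V -> R) : V :=
  xget 0 [set a : V | forall v, l v = '[a, v]].

Definition grad (V : finHilbertType R) (F : V -> R) (x : V) : V :=
  riesz ('d F x).

Definition adjoint (V W : finHilbertType R) (A : V -> W) (w : W) : V :=
  riesz (fun v => '[A v, w]).

Definition subdiff (V : finHilbertType R) (P : V -> R) (x : V) : set V :=
  [set z | forall y, P x + '[z, y - x] <= P y].

Definition conv_hull (V : lmodType R) (A : set V) : set V :=
  smallest (@convex_set R V) A.

Definition is_cone (V : lmodType R) (K : set V) : Prop :=
  forall t y, 0 <= t -> K y -> K (t *: y).

Definition pointed_cone (V : lmodType R) (K : set V) : Prop :=
  forall y, K y -> K (- y) -> y = 0.

Definition polar (V : finHilbertType R) (K : set V) : set V :=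
  [set y | forall w, K w -> '[y, w] <= 0].

Definition is_base (V : normedModType R) (Q D : set V) : Prop :=
  [/\ convex_set D,
      ~ closure D 0 &
      Q = [set t *: d | t in [set t : R | 0 <= t] & d in D]].

Definition support (V : finHilbertType R) (C : set V) (y : V) : R :=
  sup [set '[y, u] | u in C].

Definition solves (V : Type) (obj con : V -> R) (y : V) : Prop :=
  con y <= 0 /\ (forall z, con z <= 0 -> obj y <= obj z).

(* [lam] is a Lagrange multiplier at the solution [y] of the convex problem
   of minimizing [obj] subject to [con <= 0]. *)
Definition multiplier (V : Type) (obj con : V -> R) (y : V) (lam : R) : Prop :=
  [/\ 0 <= lam,
      lam * con y = 0 &
      forall z, obj y + lam * con y <= obj z + lam * con z].

End Calculus.

Section Problem.
Context {R : realType}.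

Record sMBA_data (X Y : finHilbertType R) := SMBAData {
  objf : X -> R ;
  P1 : X -> R ;
  P2 : X -> R ;
  conG : X -> Y ;
  coneK : set Y ;
  Lf : R ;
  LG : R ;
  x0 : X ;
  baseB : set Y ;
  alpha1 : R ;
  alpha2 : R ;
  alpha3 : R ;
  alpha4 : R ;
  hmu : R -> Y -> R ;
  tau1 : R ;
  tau2 : R ;
  Lhat : R ;
  Lcheck : R
}.

Context {X Y : finHilbertType R} (D : sMBA_data X Y).

Definition psi (x : X) : R := objf D x + P1 D x - P2 D x.

Definition feasible : set X := conG D @^-1` coneK D.

Definition psi_star : R := inf (psi @` feasible).

Definition DG (x : X) : X -> Y := 'd (conG D) x.

Definition Omega0 : set X := [set x | psi x <= psi (x0 D)] `&` feasible.

Definition is_KKT (eps1 eps2 eps3 : R) (x : X) : Prop :=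
  feasible x /\
  exists z v,
    [/\ feasible z,
        polar (coneK D) v,
        (edist_inf [set (a - b + grad (objf D) x + adjoint (DG x) v)%R
                   | a in subdiff (P1 D) x & b in subdiff (P2 D) z] 0%R
           <= eps1%:E)%E,
        - '[v, conG D x] <= eps2 &
        `|x - z| <= eps3].

Definition assumption_A : Prop :=
  [/\ [/\ closed (coneK D), convex_set (coneK D), is_cone (coneK D),
          pointed_cone (coneK D) & interior (coneK D) !=set0],
      [/\ 0 < Lf D, 0 <= LG D, smooth (Lf D) (objf D) &
          smooth (LG D) (conG D)],
      convex_function setT (P1 D) /\ convex_function setT (P2 D),
      interior (coneK D) (conG D (x0 D)) /\ bounded_set Omega0 &
      forall x, Omega0 x ->
        interior [set conG D x + DG x d - w | d in setT & w in coneK D] 0].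

Definition compact_base : Prop :=
  compact (baseB D) /\ is_base (polar (coneK D)) (baseB D).

Definition assumption_B : Prop :=
  [/\ [/\ 0 <= alpha1 D, 0 < alpha2 D, 0 < alpha3 D & 0 < alpha4 D],
      (forall mu, 0 < mu ->
        [/\ convex_function setT (hmu D mu),
            C1 (hmu D mu),
            (alpha1 D + alpha2 D / mu).-lipschitz (grad (hmu D mu)) &
            forall y, support (baseB D) y <= hmu D mu y
                        <= support (baseB D) y + alpha3 D * mu]) &
      (forall mu1 mu0 y, 0 < mu1 -> mu1 < mu0 ->
        hmu D mu1 y <= hmu D mu0 y - alpha4 D * (mu0 - mu1))].

Definition gB (x : X) : R := support (baseB D) (conG D x).

Definition gmu (mu : R) (x : X) : R := hmu D mu (conG D x).

(* Subproblem of the inner loop at the iterate [x], with trial constants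
   [L]. *)
Definition psi_model (x xi : X) (L : R) (y : X) : R :=
  P1 D y + '[grad (objf D) x - xi, y - x] + L / 2 * `|y - x| ^+ 2.

Definition g_model (mu : R) (x : X) (L : R) (y : X) : R :=
  gmu mu x + '[grad (gmu mu) x, y - x] + L / (2 * mu) * `|y - x| ^+ 2.

(* Index pairs (i, j) visited by a backtracking loop that starts at (0, 0),
   stops where [feas] and [desc] both hold, increments j where [feas] fails,
   and increments i and j where only [desc] fails. *)
Inductive visited (feas desc : nat -> nat -> Prop) : nat -> nat -> Prop :=
| visited_start : visited feas desc 0 0
| visited_infeas i j :
    visited feas desc i j -> ~ feas i j -> visited feas desc i j.+1
| visited_nodesc i j :
    visited feas desc i j -> feas i j -> ~ desc i j ->
    visited feas desc i.+1 j.+1.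

(* [x] is an infinite sequence of outer iterates produced by sMBA with
   smoothing parameters [mu].  [xt k i j] and [lam k i j] are the trial point
   and the multiplier of the k-th inner loop; they are constrained only at the
   visited index pairs, and ([ii k], [jj k]) is the pair that is accepted. *)
Definition sMBA_sequence (mu : nat -> R) (x : nat -> X) : Prop :=
  [/\ x 0%N = x0 D,
      0 < mu 0%N /\ gmu (mu 0%N) (x0 D) < 0,
      (forall k, 0 < mu k.+1 < mu k) &
      exists (xi : nat -> X) (Lf0 Lg0 : nat -> R)
             (xt : nat -> nat -> nat -> X) (lam : nat -> nat -> nat -> R)
             (ii jj : nat -> nat),
      forall k,
      let feas i j : Prop := gmu (mu k) (xt k i j) <= 0 in
      let desc i j : Prop :=
        psi (xt k i j) <= psi (x k)
          - (tau1 D * mu k + tau2 D * lam k i j) / (2 * mu k)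
            * `|xt k i j - x k| ^+ 2 in
      [/\ subdiff (P2 D) (x k) (xi k),
          Lcheck D <= Lf0 k <= Lhat D /\ Lcheck D <= Lg0 k <= Lhat D,
          (forall i j, visited feas desc i j ->
             let obj := psi_model (x k) (xi k) (2 ^+ i * Lf0 k) in
             let con := g_model (mu k) (x k) (2 ^+ j * Lg0 k) in
             unique (solves obj con) (xt k i j) /\
             multiplier obj con (xt k i j) (lam k i j)),
          [/\ visited feas desc (ii k) (jj k), feas (ii k) (jj k) &
              desc (ii k) (jj k)] &
          x k.+1 = xt k (ii k) (jj k)]].

(* The suprema and infima below are those of [R], which default to 0 on sets
   that are empty or unbounded; under the standing assumptions every set
   involved is nonempty and bounded. *)
Definition M_B : R := sup [set `|u| | u in baseB D].

Definition M_G : R := sup [set opnorm (DG x) | x in Omega0].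

Definition gB_star : R := inf [set gB x | x in Omega0].

Definition M_R (mu0 : R) : R :=
  Num.sqrt (mu0 ^+ 2 * Lcheck D ^- 2 * M_G ^+ 2 * M_B ^+ 2
            - 2 * mu0 * (Lcheck D)^-1 * gB_star)
  + mu0 * (Lcheck D)^-1 * M_G * M_B.

Definition Omega0_hat (mu0 : R) : set X :=
  [set a + b | a in Omega0 & b in closed_ball_ Num.norm 0 (M_R mu0)].

Definition M_G_hat (mu0 : R) : R :=
  sup [set opnorm (DG x) | x in conv_hull (Omega0_hat mu0)].

Definition L_mu (mu0 mu : R) : R :=
  M_B * LG D + alpha1 D * M_G_hat mu0 ^+ 2
  + alpha2 D * M_G_hat mu0 ^+ 2 / mu.

Definition M_L (mu0 : R) : R :=
  Lhat D * Num.max 2 (2 * (Lf D + tau1 D) / Lcheck D)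
  * Num.max 2 (Num.max (2 * tau2 D / Lcheck D)
                       (2 * mu0 * L_mu mu0 mu0 / Lcheck D)).

Definition M_f : R := sup [set `|grad (objf D) x| | x in Omega0].

Definition M_P1 (mu0 : R) : R :=
  sup [set `|z| | z in \bigcup_(x in Omega0_hat mu0) subdiff (P1 D) x].

Definition M_P2 : R :=
  sup [set `|z| | z in \bigcup_(x in Omega0) subdiff (P2 D) x].

Definition eta_spec (eta : R) : Prop :=
  0 < eta /\
  forall x u, Omega0 x -> baseB D u ->
    ~ (`|adjoint (DG x) u| ^+ 2 <= eta /\ - '[u, conG D x] <= eta).

Definition tbar_spec (mu : nat -> R) (eta : R) (tbar : nat) : Prop :=
  [/\ (0 < tbar)%N,
      mu tbar < eta / (2 * alpha3 D) &
      forall t, (0 < t < tbar)%N -> ~ (mu t < eta / (2 * alpha3 D))].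

(* The minimum over 1 <= t <= tbar, seeded with its term t = 1. *)
Definition c0 (mu : nat -> R) (tbar : nat) : R :=
  \big[Num.min/mu 0%N / mu 1%N - 1]_(1 <= t < tbar.+1) (mu t.-1 / mu t - 1).

Definition eta_bar (mu : nat -> R) (eta : R) (tbar : nat) : R :=
  Num.sqrt
    (Num.min eta
      (Num.min (2 * alpha3 D * Lcheck D)
        (Num.min (- 2 * (mu 0%N)^-1 * Lcheck D * gmu (mu 0%N) (x0 D))
                 (2 * c0 mu tbar * alpha4 D * Lcheck D)))).

Definition M_lambda (mu : nat -> R) (eta : R) (tbar : nat) : R :=
  let eb := eta_bar mu eta tbar in
  (M_f + M_P1 (mu 0%N) + M_P2) / eb
  + M_L (mu 0%N) * M_G ^+ 2 * M_B ^+ 2 * mu 0%N / (2 * Lcheck D * eb ^+ 2).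

Definition M_bar1 (mu : nat -> R) (eta : R) (tbar : nat) : R :=
  16 * M_L (mu 0%N) ^+ 2
  * Num.max (mu 0%N / tau1 D) (M_lambda mu eta tbar / tau2 D).

Definition M_bar2 (mu : nat -> R) : R :=
  (M_L (mu 0%N) + mu 0%N * LG D * M_B) / tau2 D.

End Problem.

(* Main.v *)
(** At an accepted step [x -> y] with multiplier [lam], put [d = y - x],
    [u = grad h_mu (G x)] and [v = lam u].  Since [h_mu] stays within a bounded
    distance of the support function of [B], [u] lies in [B], so [v] is in the
    polar cone.  The optimality condition of the subproblem then makes the KKT
    residual at [y] (with [z = x]) at most [2 M_L (1 + lam / mu) |d|], and its
    complementarity makes [- <v, G y>] at most
    [alpha3 lam mu + M_bar2 tau2 lam |d| ^ 2 / (2 mu)].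
    The constant [M_L] comes from the backtracking rule, and [lam <= M_lambda]
    from pairing the optimality condition with
    [w = grad g_mu x + (L_g / mu) d]: complementarity gives
    [|w| ^ 2 = |grad g_mu x| ^ 2 - 2 (L_g / mu) g_mu x >= eta_bar ^ 2].
    Averaging the descent of [psi] over [K / 2 <= k <= K] yields a step whose
    decrease [(tau1 + tau2 lam / mu) |d| ^ 2 / 2] is at most
    [2 (psi x0 - psi_star) / (K + 1)], and this single quantity controls all
    three tolerances. *)
Require Import Defs.
From HB Require Import structures.
From mathcomp Require Import all_boot all_order all_algebra.
From mathcomp Require Import sesquilinear ring lra.
From mathcomp Require Import all_classical all_reals all_analysis.

Set Implicit Arguments.
Unset Strict Implicit.
Unset Printing Implicit Defensive.

Import Order.TTheory GRing.Theory Num.Theory.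
Import numFieldNormedType.Exports.

Local Open Scope classical_set_scope.
Local Open Scope ring_scope.

Local Notation support := Defs.support.

(** * Finite-dimensional Hilbert spaces *)

(** The inner loop models [gmu] with curvature [L / mu], but [gmu] has a descent inequality with a
    fixed constant only where [DG] is bounded. Trial points are therefore confined to [Omega0_hat]
    first, from the model constraint alone; only then can a failed test be charged to a trial
    constant that is too small. Two effects of a shrinking [mu] compete: the residual carries
    [1 / mu], the complementarity gap a term proportional to [mu]. With a decrease of order [1 / K]
    and [mu] of order [K ^ (- r)], the squared residual is of order [K ^ (r - 1)], whence the
    exponent [2 / (1 - r)] on [eps1], and the gap of order [K ^ (- r)], whence [1 / r] on [eps2].
    The first lower bound on [K] makes the decrease at most [eps1 ^ 2 * mu0 * K ^ (- r) / M_bar1],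
    so its share in the gap and in the squared step length also decays like [K ^ (- r)]. This is how
    [eps1 ^ 2] enters the minimum in the second lower bound, and why the distance tolerance is
    [eps1 * sqrt eps2]. Keeping only the second half of the indices costs a factor 2 in the average
    and a factor [2 ^ r] in [mu]. *)

Lemma bounded_setP (R : realFieldType) (V : normedModType R) (A : set V) :
  bounded_set A <-> exists M, forall x, A x -> `|x| <= M.
Proof.
split=> [[M [_ MP]]|[M MP]]; first by exists (M + 1) => x Ax; apply: MP;
  rewrite ?ltrDl.
exists M; split; first exact: num_real.
by move=> N MN x Ax; apply: le_trans (MP x Ax) (ltW MN).
Qed.

Section Hilbert.
Context {R : realType} {V : finHilbertType R}.
Implicit Types (u v w : V) (a b : R).

Lemma dotpC u v : '[u, v] = '[v, u].
Proof. by rewrite hermitian_subproof expr0 mul1r. Qed.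

Lemma dotpDl u v w : '[u + v, w] = '[u, w] + '[v, w].
Proof. by rewrite linearDl. Qed.

Lemma dotpDr u v w : '[w, u + v] = '[w, u] + '[w, v].
Proof. by rewrite linearDr. Qed.

Lemma dotpNl u v : '[- u, v] = - '[u, v].
Proof. by rewrite linearNl. Qed.

Lemma dotpNr u v : '[v, - u] = - '[v, u].
Proof. by rewrite linearNr. Qed.

Lemma dotpZl a u v : '[a *: u, v] = a * '[u, v].
Proof. by rewrite linearZl_LR. Qed.

Lemma dotpZr a u v : '[v, a *: u] = a * '[v, u].
Proof. by rewrite linearZr_LR. Qed.

Lemma dotp0l u : '[(0 : V), u] = 0.
Proof. by rewrite linear0l. Qed.

Lemma dotp0r u : '[u, (0 : V)] = 0.
Proof. by rewrite linear0r. Qed.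

Definition dotpE := (dotpDl, dotpDr, dotpNl, dotpNr, dotpZl, dotpZr).

Lemma dotp_suml I (r : seq I) (P : pred I) (F : I -> V) v :
  '[\sum_(i <- r | P i) F i, v] = \sum_(i <- r | P i) '[F i, v].
Proof. by rewrite (linear_sumlz). Qed.

Lemma dotp_sumr I (r : seq I) (P : pred I) (F : I -> V) v :
  '[v, \sum_(i <- r | P i) F i] = \sum_(i <- r | P i) '[v, F i].
Proof. by rewrite linear_sumr. Qed.

Lemma dotp_ge0 u : 0 <= '[u, u].
Proof. by rewrite dotp_norm sqr_ge0. Qed.

Lemma dotp_eq0 u : '[u, u] = 0 -> u = 0.
Proof. by rewrite dotp_norm => /eqP; rewrite sqrf_eq0 normr_eq0 => /eqP. Qed.

Lemma dotp_inj u v : (forall w, '[u, w] = '[v, w]) -> u = v.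
Proof.
by move=> uv; apply/subr0_eq/dotp_eq0; rewrite dotpDl dotpNl uv subrr.
Qed.

Lemma CauchySchwarz_dotp u v : '[u, v] <= `|u| * `|v|.
Proof.
have [->|v0] := eqVneq v 0; first by rewrite dotp0r normr0 mulr0.
have v_gt0 : 0 < `|v| by rewrite normr_gt0.
have := dotp_ge0 (`|v| ^+ 2 *: u - '[u, v] *: v).
rewrite !dotpE (dotpC v u) !dotp_norm => h.
have : 0 <= (`|u| * `|v|) ^+ 2 - '[u, v] ^+ 2.
  rewrite -(pmulr_rge0 _ (exprn_gt0 2 v_gt0)); apply: le_trans h _; lra.
rewrite subr_ge0 -ler_sqrt ?sqr_ge0// !sqrtr_sqr => h2.
rewrite (le_trans (ler_norm _))// (le_trans h2)//.
by rewrite ger0_norm ?mulr_ge0.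
Qed.

Lemma normr_dotp u v : `|'[u, v]| <= `|u| * `|v|.
Proof.
rewrite ler_norml CauchySchwarz_dotp andbT lerNl -dotpNl.
by rewrite (le_trans (CauchySchwarz_dotp _ _))// normrN.
Qed.

(* The coefficients of [a] in a basis solve the linear system of its Gram
   matrix. *)
Lemma riesz_representation (l : V -> R) : scalar l ->
  exists a : V, forall v, l v = '[a, v].
Proof.
move=> lin_l.
have l0 : l 0 = 0 by have := lin_l (-1) 0 0; rewrite scaler0 addr0; lra.
pose n := \dim {: V}; pose e := vbasis {: V}.
have eP : basis_of fullv e by exact: vbasisP.
pose G := \matrix_(i < n, j < n) '[e`_i, e`_j].
have Gsum (c : 'rV_n) j : (c *m G) 0 j = '[\sum_i c 0 i *: e`_i, e`_j].
  rewrite mxE dotp_suml; apply: eq_bigr => i _.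
  by rewrite mxE dotpZl.
have Gunit : G \in unitmx.
  rewrite -row_free_unit; apply: inj_row_free => c cG0.
  have a0 : \sum_i c 0 i *: e`_i = 0.
    apply: dotp_eq0; rewrite dotp_sumr big1// => j _.
    by rewrite dotpZr -Gsum cG0 mxE mulr0.
  apply/rowP => i; rewrite mxE.
  by have /freeP := basis_free eP; apply.
pose c := (\row_j l e`_j) *m invmx G.
exists (\sum_i c 0 i *: e`_i) => v.
have lsum k (F : 'I_k -> V) (z : 'I_k -> R) :
    l (\sum_i z i *: F i) = \sum_i z i * l (F i).
  elim/big_rec2 : _ => // i y1 y2 _ <-; exact: lin_l.
rewrite [in LHS](coord_basis eP (memvf v)) [in RHS](coord_basis eP (memvf v)).
rewrite lsum dotp_sumr; apply: eq_bigr => j _.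
by rewrite dotpZr -Gsum mulmxKV// mxE.
Qed.

Lemma rieszE (l : V -> R) v : scalar l -> '[riesz l, v] = l v.
Proof.
move=> /riesz_representation h; rewrite /riesz.
by have /= <- := xgetPex 0 h.
Qed.

Lemma scalar_bounded (l : V -> R) : scalar l ->
  exists2 C : R, 0 <= C & forall v, `|l v| <= C * `|v|.
Proof.
move=> /riesz_representation[a la]; exists `|a| => // v.
by rewrite la normr_dotp.
Qed.

Let n : nat := \dim {: V}.
Let e := vbasis {: V}.

Lemma basis_expansion v : v = \sum_i coord e i v *: e`_i.
Proof. by apply: coord_basis; [exact: vbasisP|exact: memvf]. Qed.

(** A coordinate is a linear form, hence bounded by Riesz and Cauchy-Schwarz. This plays the part of
    the equivalence of norms in finite dimension. *)
Lemma coord_bounded :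
  exists2 C : R, 0 <= C & forall i v, `|coord e i v| <= C * `|v|.
Proof.
have /choice[C CP] : forall i, exists C, 0 <= C /\
    forall v, `|coord e i v| <= C * `|v|.
  move=> i; have [|C C0 CP] := @scalar_bounded (coord e i); last by exists C.
  by move=> a u v; rewrite linearP.
exists (\sum_i C i) => [|i v]; first by rewrite sumr_ge0// => i _; case: (CP i).
apply: le_trans (proj2 (CP i) v) _; rewrite ler_wpM2r//.
by rewrite (bigD1 i)//= lerDl sumr_ge0// => j _; case: (CP j).
Qed.

Lemma linear_bounded (W : normedModType R) (A : V -> W) : linear A ->
  exists2 C : R, 0 <= C & forall v, `|A v| <= C * `|v|.
Proof.
move=> linA; have [C C0 CP] := coord_bounded.
exists (\sum_(i < n) C * `|A e`_i|) => [|v]; first by rewrite sumr_ge0// => i _;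
  rewrite mulr_ge0.
have A0 : A 0 = 0.
  by have := linA (-1) 0 0; rewrite scaler0 addr0 scaleN1r addNr.
have Asum k (F : 'I_k -> V) (z : 'I_k -> R) :
    A (\sum_i z i *: F i) = \sum_i z i *: A (F i).
  elim/big_rec2 : _ => // i y1 y2 _ <-; exact: linA.
rewrite {1}(basis_expansion v) Asum mulr_suml (le_trans (ler_norm_sum _ _ _))//.
by apply: ler_sum => i _; rewrite normrZ mulrAC ler_wpM2r.
Qed.

(** Heine-Borel for row vectors, carried over by the map [phi] from coordinates to vectors: [phi] is
    continuous, and [coord_bounded] keeps the preimage of [A] bounded. *)
Lemma finHilbert_bounded_closed_compact (A : set V) :
  bounded_set A -> closed A -> compact A.
Proof.
move=> bA cA; have [C C0 CP] := coord_bounded.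
pose phi (c : 'rV[R]_n) : V := \sum_i c 0 i *: e`_i.
have cphi : continuous phi.
  rewrite /phi; elim: (index_enum _) => [c|i r ih c].
    rewrite (_ : (fun _ => _) = cst 0); first exact: cst_continuous.
    by apply/funext => ?; rewrite big_nil.
  rewrite (_ : (fun _ => _) = fun d : 'rV[R]_n =>
    d 0 i *: e`_i + \sum_(j <- r) d 0 j *: e`_j).
    have h : (fun d : 'rV[R]_n => d 0 i *: e`_i) @ c --> c 0 i *: e`_i.
      apply: (@cvgZr_tmp _ _ _ (nbhs c) _ (fun d : 'rV[R]_n =>
        d 0 i) (c 0 i) (e`_i)).
      exact: (@coord_continuous R 1 n 0 i c).
    exact: (@cvgD _ _ _ (nbhs c) _ _ _ _ _ h (ih c)).
  by apply/funext => d; rewrite big_cons.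
have -> : A = phi @` (phi @^-1` A).
  apply/seteqP; split => [v Av|_ [c ? <-]//].
  exists (\row_i coord e i v) => /=.
    by rewrite (_ : phi _ = v)// [RHS]basis_expansion; apply: eq_bigr => i _;
      rewrite mxE.
  by rewrite [RHS]basis_expansion; apply: eq_bigr => i _; rewrite mxE.
apply: continuous_compact; first exact: continuous_subspaceT.
apply: bounded_closed_compact; last first.
  by have /continuous_closedP := cphi; exact.
have /bounded_setP[M MP] := bA; apply/bounded_setP.
exists (C * `|M|) => c /= /MP phiM.
have c_le i : `|c 0 i| <= C * `|M|.
  have -> : c 0 i = coord e i (phi c).
    by rewrite coord_sum_free// (basis_free (vbasisP _)).
  by rewrite (le_trans (CP _ _))// ler_wpM2l// (le_trans phiM)// ler_norm.
rewrite [leLHS]mx_normrE; apply/bigmax_leP; split; first by rewrite mulr_ge0.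
by case=> i j _ /=; rewrite (ord1 i).
Qed.

End Hilbert.

(** * Convexity *)

Section Convex.
Context {R : realType}.

Lemma convex_setE (V : lmodType R) (A : set V) x y (t : R) :
  convex_set A -> A x -> A y -> 0 <= t <= 1 -> A (t *: x + (1 - t) *: y).
Proof.
move=> cA Ax Ay /andP[t0 t1].
by have := cA x y (Itv01 t0 t1); rewrite !inE; apply.
Qed.

Lemma convex_functionE (V : lmodType R) (F : V -> R) x y (t : R) :
  convex_function setT F -> 0 <= t <= 1 ->
  F (t *: x + (1 - t) *: y) <= t * F x + (1 - t) * F y.
Proof.
move=> cF /andP[t0 t1].
by have := cF (Itv01 t0 t1) x y; rewrite !inE; apply.
Qed.

(** Stands in for the limit [t -> 0]: the first-order conditions below come from an inequality on a
    segment which, divided by [t], has this shape. *)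
Lemma affine_ge0_at0 (a b : R) :
  (forall t, 0 < t <= 1 -> 0 <= a + t * b) -> 0 <= a.
Proof.
move=> h; rewrite leNgt; apply/negP => a0.
have d0 : 0 < `|b| - a + 1 by have := normr_ge0 b; lra.
pose t := - a / (`|b| - a + 1).
have t0 : 0 < t by rewrite divr_gt0 ?oppr_gt0.
have t1 : t <= 1 by rewrite ler_pdivrMr// mul1r; have := normr_ge0 b; lra.
have := h t; rewrite t0 t1 => /(_ isT).
have : t * (`|b| - a + 1) = - a by rewrite divfK// gt_eqF.
have : t * b <= t * `|b| by rewrite ler_wpM2l ?ler_norm// ltW.
by nra.
Qed.

Context {V : finHilbertType R}.
Implicit Types (u v w x y z : V).

Lemma normD_sqr u v : `|u + v| ^+ 2 = `|u| ^+ 2 + 2 * '[u, v] + `|v| ^+ 2.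
Proof. by rewrite -!dotp_norm !dotpE (dotpC v u); ring. Qed.

Lemma projection_convex (A : set V) u : closed A -> convex_set A -> A !=set0 ->
  exists2 p, A p & forall b, A b -> '[u - p, b - p] <= 0.
Proof.
move=> clA cA [a Aa].
(* Keeping only the points no farther from [u] than [a] gives a compact set with the same minimum of
   the distance. *)
pose S := A `&` [set v | `|v - u| <= `|a - u|].
have cdist : continuous (fun v => `|v - u|).
  by move=> v; apply: cvg_norm; apply: cvgB => //; exact: cvg_cst.
have bS : bounded_set S.
  apply/bounded_setP; exists (`|a - u| + `|u|) => v [_ /=].
  by rewrite -[in X in _ -> X](subrK u v) => /lerD/(_ (lexx `|u|));
    apply/le_trans/ler_normD.
have clS : closed S.
  apply: closedI => //; apply: (@preimage_closed _ _ (fun v =>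
    `|v - u|) [set r : R | r <= `|a - u|]).
    by move=> v _; exact: cdist.
  exact: closed_le.
have [|p pS pmin] := compact_EVT_min _ (finHilbert_bounded_closed_compact bS clS)
  (continuous_subspaceT cdist).
  by exists a; split => /=.
move: pS; rewrite inE => -[Ap /= p_le].
exists p => // b Ab; rewrite -oppr_ge0.
apply: (@affine_ge0_at0 _ (`|b - p| ^+ 2 / 2)) => t /andP[t0 t1].
have At : A (t *: b + (1 - t) *: p) by apply: convex_setE => //; rewrite ltW.
have : `|p - u| <= `|t *: b + (1 - t) *: p - u|.
  have [h|/ltW h] := leP `|t *: b + (1 - t) *: p - u| `|a - u|.
    by apply: pmin; rewrite inE; split.
  exact: le_trans p_le h.
have -> : t *: b + (1 - t) *: p - u = (p - u) + t *: (b - p).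
  rewrite scalerBl scale1r scalerBr [RHS]addrACA [in LHS]addrA -[LHS]addrA.
  by congr (_ + _); rewrite addrC.
rewrite -ler_sqr ?nnegrE// (normD_sqr (p - u)) dotpZr normrZ exprMn.
rewrite -(opprB p u) dotpNl (ger0_norm (ltW t0)) => h.
by rewrite -(pmulr_rge0 _ t0); nra.
Qed.

Lemma ge0_linear_bounded_le0 (a K : R) : (forall t, 0 < t -> t * a <= K) -> a <= 0.
Proof.
move=> h; rewrite leNgt; apply/negP => a0.
have K0 : 0 <= K by have := h 1 ltr01; lra.
have := h ((K + 1) / a); rewrite divfK ?gt_eqF// divr_gt0//; last lra.
by move=> /(_ isT); lra.
Qed.

Lemma support_ub (C : set V) u v : bounded_set C -> C u -> '[v, u] <= support C v.
Proof.
move=> /bounded_setP[M CM] Cu; apply: ub_le_sup; last by exists u.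
exists (`|v| * M) => _ [w Cw <-].
by rewrite (le_trans (CauchySchwarz_dotp _ _))// ler_wpM2l// CM.
Qed.

Lemma support_le (C : set V) v K : C !=set0 ->
  (forall u, C u -> '[v, u] <= K) -> support C v <= K.
Proof.
move=> [u Cu] h; apply: ge_sup; first by exists '[v, u], u.
by move=> _ [w Cw <-]; exact: h.
Qed.

(* A subgradient separated from [C] by a direction [w] would make [F] grow
   faster than the support function along [w]. *)
Lemma subdiff_support (C : set V) (F : V -> R) (c : R) y u :
  compact C -> convex_set C -> C !=set0 ->
  (forall z, F z <= support C z + c) -> subdiff F y u -> C u.
Proof.
move=> cC cvC C0 Fle Fu.
have bC : bounded_set C by exact: compact_bounded.
have clC : closed C by apply: compact_closed => //; exact: norm_hausdorff.
have [p Cp pP] := projection_convex u clC cvC C0.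
have : '[u - p, u - p] <= 0.
  apply: (@ge0_linear_bounded_le0 _ (support C y + c - F y)) => t t0.
  have := le_trans (Fu (y + t *: (u - p))) (Fle _).
  rewrite [y + _]addrC addrK [_ + y]addrC dotpZr => h.
  have : support C (y + t *: (u - p)) <= support C y + t * '[u - p, p].
    apply: support_le => // b Cb; rewrite dotpDl dotpZl lerD ?support_ub//.
    by rewrite (ler_wpM2l (ltW t0))// -subr_le0 -dotpNr -dotpDr pP.
  move: h; rewrite (_ : '[u, u - p] = '[u - p, u - p] + '[u - p, p]); first nra.
  by rewrite (dotpC _ p) -dotpDl subrK.
move=> h; suff -> : u = p by [].
by apply/subr0_eq/dotp_eq0/le_anti; rewrite h dotp_ge0.
Qed.

(** Moreau decomposition: the residual [y - p] of the projection [p] of [y] is polar to [K] and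
    orthogonal to [p], hence equal to [t *: d] with [d] in the base. Then [|y - p| ^ 2 = t * '[y, d]
    <= 0], so [y = p]. *)
Lemma mem_cone_of_support_le0 (K C : set V) y :
  closed K -> convex_set K -> is_cone K -> K !=set0 ->
  bounded_set C -> is_base (polar K) C -> support C y <= 0 -> K y.
Proof.
move=> clK cvK coneK K0 bC [_ _ baseC] supp_le0.
have [p Kp pP] := projection_convex y clK cvK K0.
have K00 : K 0.
  by case: K0 => k Kk; rewrite -(scale0r k); apply: coneK.
(* The variational inequality at [0] and at [2 *: p] bounds this product from both sides. *)
have wp : '[y - p, p] = 0.
  have := pP _ K00; rewrite sub0r dotpNr.
  have := pP _ (coneK 2 p (ler0n _ 2) Kp); rewrite scaler_nat mulr2n addrK.
  by lra.
have : polar K (y - p).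
  by move=> k /pP; rewrite dotpDr dotpNr wp subr0.
rewrite baseC => -[t /= t0 [d Cd tdE]].
have := dotp_ge0 (y - p).
have : '[y - p, y - p] <= 0.
  rewrite dotpDr dotpNr wp subr0 dotpC -tdE dotpZr mulr_ge0_le0//.
  exact: le_trans (support_ub _ bC Cd) supp_le0.
move=> h1 h2; suff -> : y = p by [].
by apply/subr0_eq/dotp_eq0/le_anti; rewrite h1 h2.
Qed.

(** From above, splitting off one coordinate at a time as a midpoint leaves values of [P] at [0] and
    at finitely many multiples of basis vectors. From below, [0] is the midpoint of [v] and [- v],
    so [P v >= 2 * P 0 - P (- v)]. *)
Lemma convex_function_bounded (P : V -> R) (r : R) :
  convex_function setT P -> exists C, forall v, `|v| <= r -> `|P v| <= C.
Proof.
move=> cP; have [B B0 BP] := @coord_bounded R V.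
set e := vbasis _ in BP.
(* Each midpoint doubles the remaining coefficients, so the induction has to run over all [K] at
   once. *)
have sum_bound (s : seq 'I_(\dim {: V})) (K : R) : 0 < K ->
    exists C, forall c : 'I_(\dim {: V}) -> R, (forall i, `|c i| <= K) ->
      P (\sum_(i <- s) c i *: e`_i) <= C.
  elim: s K => [|j s ih] K K0.
    by exists (P 0) => c _; rewrite big_nil.
  have [|C CP] := ih (2 * K); first lra.
  exists (2^-1 * (`|P ((2 * K) *: e`_j)| + `|P (- (2 * K) *: e`_j)|) + 2^-1 * C)
    => c cK.
  rewrite big_cons.
  have -> : c j *: e`_j + \sum_(i <- s) c i *: e`_i =
      2^-1 *: ((2 * c j) *: e`_j) + (1 - 2^-1) *: \sum_(i <- s) (2 * c i) *: e`_i.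
    rewrite scalerA mulrA mulVf// mul1r scaler_sumr; congr (_ + _).
    apply: eq_bigr => i _; rewrite scalerA; congr (_ *: _); lra.
  apply: le_trans (convex_functionE _ _ cP _) _; first by lra.
  have -> : 1 - 2^-1 = 2^-1 :> R by lra.
  have K2 : `|2 * c j| <= 2 * K by rewrite normrM ger0_norm// ler_wpM2l.
  rewrite lerD// ler_wpM2l// ?invr_ge0//.
  (* The weight that places [2 * c j] between the endpoints [- (2 * K)] and [2 * K]. *)
  pose t := (c j / K + 1) / 2.
  have tK : t * (2 * K) = c j + K by rewrite /t; field; rewrite gt_eqF.
  have [cl cu] : - K <= c j /\ c j <= K by apply/andP; rewrite -ler_norml.
  have t01 : 0 <= t <= 1.
    by apply/andP; split; rewrite -(ler_pM2r K0); lra.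
  have -> : (2 * c j) *: e`_j =
      t *: ((2 * K) *: e`_j) + (1 - t) *: (- (2 * K) *: e`_j).
    by rewrite !scalerA -scalerDl; congr (_ *: _); lra.
  apply: le_trans (convex_functionE _ _ cP t01) _.
  have := ler_norm (P ((2 * K) *: e`_j)); have := ler_norm (P (- (2 * K) *: e`_j)).
  have := normr_ge0 (P ((2 * K) *: e`_j)); have := normr_ge0 (P (- (2 * K) *: e`_j)).
  by move: t01 => /andP[? ?]; nra.
  apply: CP => i.
  by rewrite normrM ger0_norm// ler_wpM2l.
have [|C CP] := sum_bound (index_enum _) (B * `|r| + 1).
  by rewrite ltr_wpDl ?mulr_ge0.
have Pub v : `|v| <= r -> P v <= C.
  move=> vr; rewrite (basis_expansion v); apply: CP => i.
  rewrite (le_trans (BP _ _))// (@le_trans _ _ (B * `|r|)) ?lerDl//.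
  by rewrite ler_wpM2l// (le_trans vr)// ler_norm.
exists (`|C| + 2 * `|P 0|) => v vr.
have := Pub v vr; have := Pub (- v); rewrite normrN => /(_ vr) Nv Pv.
have := @convex_functionE _ _ v (- v) 2^-1 cP.
rewrite (_ : 1 - 2^-1 = 2^-1 :> R); last lra.
rewrite scalerN subrr => cv; have P0 : P 0 <= 2^-1 * P v + 2^-1 * P (- v) by
  apply: cv; lra.
rewrite ler_norml.
by have := ler_norm C; have := ler_norm (- P 0); rewrite normrN;
  have := normr_ge0 (P 0); lra.
Qed.

(** Testing the subgradient inequality one unit from [x] in the direction of [z] gives
    [|z| <= P (x + z / |z|) - P x]; hence a bound of [P] on the ball of radius [r + 1]. *)
Lemma subdiff_bounded (P : V -> R) (r : R) : convex_function setT P ->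
  exists C, forall x z, `|x| <= r -> subdiff P x z -> `|z| <= C.
Proof.
move=> /(@convex_function_bounded _ (r + 1))[C CP].
exists (2 * C) => x z xr Pz.
have [->|z0] := eqVneq z 0.
  by rewrite normr0; have := CP x; have := normr_ge0 (P x); lra.
have z_gt0 : 0 < `|z| by rewrite normr_gt0.
have := Pz (x + `|z|^-1 *: z).
rewrite [_ - x]addrC addKr dotpZr dotp_norm expr2 mulKf ?gt_eqF// => h.
have := CP x; have := CP (x + `|z|^-1 *: z).
have -> : `|x + `|z|^-1 *: z| <= r + 1.
  by rewrite (le_trans (ler_normD _ _))// normrZ normfV normr_id mulVf ?gt_eqF//
    lerD.
have -> : `|x| <= r + 1 by lra.
rewrite !ler_norml => /(_ isT)/andP[_ h1] /(_ isT)/andP[h2 _]; lra.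
Qed.

Lemma opnorm_ub (W : normedModType R) (A : V -> W) v : linear A ->
  `|A v| <= opnorm A * `|v|.
Proof.
move=> linA; have [C C0 CP] := linear_bounded linA.
have A0 : A 0 = 0.
  by have := linA (-1) 0 0; rewrite scaler0 addr0 scaleN1r addNr.
have [->|v0] := eqVneq v 0; first by rewrite A0 !normr0 mulr0.
have v_gt0 : 0 < `|v| by rewrite normr_gt0.
rewrite -ler_pdivrMr// mulrC -[`|v|^-1]ger0_norm ?invr_ge0// -normrZ.
apply: ub_le_sup.
  by exists C => _ [u /= u1 <-]; rewrite (le_trans (CP u))// ler_piMr.
exists (`|v|^-1 *: v) => /=.
  by rewrite normrZ normfV normr_id mulVf ?gt_eqF.
by rewrite -[in LHS](addr0 (_ *: v)) linA A0 addr0.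
Qed.

Lemma opnorm_ge0 (W : normedModType R) (A : V -> W) : linear A -> 0 <= opnorm A.
Proof.
move=> linA; have [C C0 CP] := linear_bounded linA.
apply: le_trans (normr_ge0 (A 0)) _; apply: ub_le_sup; last by exists 0;
  rewrite //= normr0.
by exists C => _ [u /= u1 <-]; rewrite (le_trans (CP u))// ler_piMr.
Qed.

Lemma opnorm_le (W : normedModType R) (A : V -> W) K :
  0 <= K -> (forall v, `|A v| <= K * `|v|) -> opnorm A <= K.
Proof.
move=> K0 AK; apply: ge_sup; first by exists `|A 0|, 0; rewrite //= normr0.
by move=> _ [v /= v1 <-]; rewrite (le_trans (AK v))// ler_piMr.
Qed.

End Convex.

(** * Differential calculus *)

Section Derivatives.
Context {R : realType}.

(** The codomain [R^o] is a normed module, so that [dotp u] can be registered as a linear map and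
    the rules for differentiating linear maps apply. *)
Definition dotp_form (V : finHilbertType R) (u : V) : V -> R^o := dotp u.

Lemma dotp_form_linear (V : finHilbertType R) (u : V) : linear (dotp_form u).
Proof. by move=> a v w; rewrite /dotp_form !dotpE. Qed.

HB.instance Definition _ (V : finHilbertType R) (u : V) :=
  GRing.isLinear.Build R V R^o _ (dotp_form u) (dotp_form_linear u).

Lemma dotp_form_continuous (V : finHilbertType R) (u : V) : continuous (dotp_form u).
Proof.
apply/linear_bounded_continuous; exists `|u|; split; first exact: num_real.
move=> M uM; near=> v => /=; rewrite (le_trans (normr_dotp _ _))//.
rewrite (le_trans _ (ltW uM))// ler_piMr// ltW//.
Unshelve. all: by end_near. Qed.

Lemma differentiable_dotp (V : normedModType R) (W : finHilbertType R)
    (F : V -> W) (u : W) x :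
  differentiable F x -> differentiable (fun z => '[u, F z] : R^o) x.
Proof.
move=> dF; apply: (differentiable_comp dF).
exact: (linear_differentiable _ (@dotp_form_continuous _ u)).
Qed.

Lemma diff_dotp (V : normedModType R) (W : finHilbertType R)
    (F : V -> W) (u : W) x v :
  differentiable F x -> 'd (fun z => '[u, F z] : R^o) x v = '[u, 'd F x v].
Proof.
move=> dF; have cu := @dotp_form_continuous _ u.
have -> : (fun z => '[u, F z] : R^o) = dotp_form u \o F by [].
rewrite diff_comp//; last exact: (linear_differentiable _ cu).
by rewrite [in LHS]/= diff_lin.
Qed.

Lemma is_derive_line (V : normedModType R) (F : V -> R^o) (x d : V) (t : R) :
  differentiable F (x + t *: d) ->
  is_derive t 1 (fun s : R => F (x + s *: d)) ('d F (x + t *: d) d).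
Proof.
move=> dF.
have dl : is_diff t (cst x + *:%R^~ d) (0 + *:%R^~ d).
  exact: is_diffD.
have dFl : is_diff (x + t *: d) F ('d F (x + t *: d)) by exact: DiffDef.
have [dc dcE] : is_diff t (F \o (cst x + *:%R^~ d)) ('d F (x + t *: d) \o (0 +
  *:%R^~ d)).
  exact: is_diff_comp.
apply: DeriveDef; first exact: diff_derivable dc.
rewrite (deriveE _ dc) dcE /=.
by rewrite [X in 'd _ _ X](_ : _ = d)//; rewrite fctE /= add0r scale1r.
Qed.

(** The mean value theorem is applied to [F] on the segment minus the primitive of its slope bound.
    This takes the place of integrating the derivative and preserves the factor [1 / 2] on [K]. *)
Lemma descent_line (V : normedModType R) (F : V -> R^o) (x d : V) (a K : R) :
  (forall z, differentiable F z) ->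
  (forall t : R, 0 <= t <= 1 -> 'd F (x + t *: d) d <= a + K * t) ->
  F (x + d) <= F x + a + K / 2.
Proof.
move=> dF dFle.
pose phi t : R := F (x + t *: d) - (t * a + K / 2 * t ^+ 2).
pose dphi t : R := 'd F (x + t *: d) d - (a + K * t).
have phiP (t : R) : is_derive t 1 phi (dphi t).
  have dFt := is_derive_line (dF (x + t *: d)).
  have : is_derive t 1 (fun s : R => s * a + K / 2 * s ^+ 2 : R^o) (a + K * t).
    apply: is_derive_eq; rewrite /GRing.scale /=; lra.
  move=> h.
  exact: is_deriveB.
have [|c c01] := @MVT_segment _ phi dphi 0 1 ler01 (fun x _ => phiP x).
  apply: derivable_within_continuous => t _.
  exact: ex_derive.
rewrite /phi /dphi subr0 mulr1 scale1r scale0r addr0.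
have := dFle c; move: c01; rewrite in_itv /= => c01 /(_ c01).
by lra.
Qed.

End Derivatives.

Section Grad.
Context {R : realType} {V : finHilbertType R}.
Implicit Types (x y v : V).

Lemma gradE (F : V -> R) x v : '[grad F x, v] = 'd F x v.
Proof. by rewrite rieszE// => a u w; rewrite linearP. Qed.

End Grad.

Section Gradients.
Context {R : realType} {V : finHilbertType R}.
Implicit Types (x y v : V).

Lemma adjointE (W : finHilbertType R) (A : V -> W) (w : W) v :
  linear A -> '[adjoint A w, v] = '[A v, w].
Proof. by move=> linA; rewrite rieszE// => a u u'; rewrite linA !dotpE. Qed.

Lemma adjointZ (W : finHilbertType R) (A : V -> W) (a : R) (w : W) :
  linear A -> adjoint A (a *: w) = a *: adjoint A w.
Proof. by move=> linA; apply: dotp_inj => v; rewrite dotpZl !adjointE// dotpZr. Qed.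

Lemma grad_comp (W : finHilbertType R) (G : V -> W) (h : W -> R) x v :
  differentiable G x -> differentiable h (G x) ->
  '[grad (fun z => h (G z)) x, v] = '[grad h (G x), 'd G x v].
Proof.
move=> dG dh; rewrite !gradE.
by rewrite -[LHS]/('d (h \o G) x v) diff_comp// gradE.
Qed.

Lemma linear_diffB (W : normedModType R) (F : V -> W) x y :
  linear (fun v => 'd F x v - 'd F y v).
Proof.
move=> a u w; have D z : 'd F z (a *: u + w) = a *: 'd F z u + 'd F z w.
  exact: linearP.
by rewrite !D scalerBr opprD addrACA.
Qed.

Lemma smooth_diffB (W : normedModType R) (L : R) (F : V -> W) x y v :
  smooth L F -> `|'d F x v - 'd F y v| <= L * `|x - y| * `|v|.
Proof.
move=> [_ FL]; apply: le_trans (ler_wpM2r (normr_ge0 v) (FL x y)).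
exact/(@opnorm_ub _ _ _ (fun v => 'd F x v - 'd F y v))/linear_diffB.
Qed.

Lemma lipschitz_grad_descent (k : R) (F : V -> R) x y :
  (forall z, differentiable F z) ->
  (forall x y, `|grad F x - grad F y| <= k * `|x - y|) ->
  F y <= F x + '[grad F x, y - x] + k * `|y - x| ^+ 2 / 2.
Proof.
move=> dF Fk; rewrite -[in F y](subrK x y) addrC.
apply: descent_line => // t /andP[t0 _].
rewrite -lerBlDl -!gradE -dotpNl -dotpDl.
apply: le_trans (CauchySchwarz_dotp _ _) _.
apply: le_trans (ler_wpM2r (normr_ge0 _) (Fk _ _)) _.
by rewrite [x + _]addrC addrK normrZ ger0_norm//; lra.
Qed.

Lemma smooth_grad_lipschitz (L : R) (F : V -> R) x y :
  smooth L F -> `|grad F x - grad F y| <= L * `|x - y|.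
Proof.
move=> sF; set g := _ - _; have [->|g0] := eqVneq g 0.
  rewrite normr0; case: sF => _ sF; apply: le_trans (sF x y);
    exact/opnorm_ge0/linear_diffB.
rewrite -(ler_pM2r (x := `|g|)) ?normr_gt0// -expr2 -dotp_norm.
rewrite {1}/g dotpDl dotpNl !gradE (le_trans (ler_norm _))//.
exact: smooth_diffB.
Qed.

Lemma smooth_descent (L : R) (F : V -> R) x y : smooth L F ->
  F y <= F x + '[grad F x, y - x] + L * `|y - x| ^+ 2 / 2.
Proof.
move=> sF; apply: lipschitz_grad_descent => [|u v]; first by case: sF => -[].
exact: smooth_grad_lipschitz.
Qed.

Lemma smooth_dotp_descent (W : finHilbertType R) (L : R) (G : V -> W) x y (u : W) :
  smooth L G ->
  '[u, G y] <= '[u, G x] + '[u, 'd G x (y - x)] + `|u| * L * `|y - x| ^+ 2 / 2.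
Proof.
move=> sG; have dG z : differentiable G z by case: sG => -[].
rewrite -[in G y](subrK x y) addrC.
apply: (descent_line (F := fun z => '[u, G z])).
  by move=> z; exact: differentiable_dotp.
move=> t /andP[t0 _]; rewrite diff_dotp// -lerBlDl -dotpNr -dotpDr.
apply: le_trans (CauchySchwarz_dotp _ _) _.
apply: le_trans (ler_wpM2l (normr_ge0 _) (smooth_diffB _ _ _ sG)) _.
by rewrite [x + _]addrC addrK normrZ ger0_norm//; lra.
Qed.

(** Pairing with the increment [w] itself reduces the vector-valued mean value inequality to
    [descent_line] with [K = 0]. *)
Lemma norm_diff_le (W : finHilbertType R) (M : R) (G : V -> W) x y :
  (forall z, differentiable G z) ->
  (forall t, 0 <= t <= 1 -> opnorm ('d G (x + t *: (y - x))) <= M) ->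
  `|G y - G x| <= M * `|y - x|.
Proof.
move=> dG GM; set w := G y - G x.
have M0 : 0 <= M.
  by apply: le_trans (GM 0 _); [apply: opnorm_ge0;
    exact: linearP|rewrite lexx ler01].
have [->|w0] := eqVneq w 0; first by rewrite normr0 mulr_ge0.
rewrite -(ler_pM2l (x := `|w|)) ?normr_gt0// -expr2 -dotp_norm.
rewrite {2}/w dotpDr dotpNr lerBlDl -[in G y](subrK x y) [y - x + x]addrC.
rewrite -[leRHS]addr0 -(mul0r 2^-1).
apply: (descent_line (F := fun z => '[w, G z])).
  by move=> z; exact: differentiable_dotp.
move=> t t01; rewrite diff_dotp// mul0r addr0.
apply: le_trans (CauchySchwarz_dotp _ _) _; rewrite ler_wpM2l//.
apply: le_trans (opnorm_ub _ _) _; first exact: linearP.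
by rewrite ler_wpM2r// GM.
Qed.

Lemma smooth_opnorm_bounded (W : normedModType R) (L : R) (G : V -> W) (r : R) :
  0 <= L -> smooth L G ->
  exists2 C, 0 <= C & forall x, `|x| <= r -> opnorm ('d G x) <= C.
Proof.
move=> L0 sG; have C0 : 0 <= opnorm ('d G 0) + L * `|r|.
  by rewrite addr_ge0 ?mulr_ge0//; apply: opnorm_ge0; exact: linearP.
exists (opnorm ('d G 0) + L * `|r|) => // x xr.
apply: opnorm_le => // v; rewrite mulrDl -[in leLHS](subrK ('d G 0 v) ('d G x v)).
rewrite (le_trans (ler_normD _ _))// addrC lerD//.
  by apply: opnorm_ub; exact: linearP.
apply: le_trans (smooth_diffB _ _ _ sG) _; rewrite subr0 ler_wpM2r// ler_wpM2l//.
by rewrite (le_trans xr)// ler_norm.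
Qed.

Lemma smooth_norm_bounded (W : finHilbertType R) (L : R) (G : V -> W) (r : R) :
  0 <= L -> smooth L G -> exists C, forall x, `|x| <= r -> `|G x| <= C.
Proof.
move=> L0 sG; have [C C0 CP] := smooth_opnorm_bounded r L0 sG.
have dG z : differentiable G z by case: sG => -[].
exists (C * `|r| + `|G 0|) => x xr.
rewrite -[G x](subrK (G 0)) (le_trans (ler_normD _ _))// lerD2r.
apply: le_trans (norm_diff_le (M := C) dG _) _ => [t /andP[t0 t1]|].
  apply: CP; rewrite subr0 add0r normrZ ger0_norm//.
  by rewrite (le_trans _ xr)// ler_piMl.
by rewrite subr0 ler_wpM2l// (le_trans xr)// ler_norm.
Qed.

Lemma smooth_grad_bounded (L : R) (F : V -> R) (r : R) :
  0 <= L -> smooth L F -> exists C, forall x, `|x| <= r -> `|grad F x| <= C.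
Proof.
move=> L0 sF; exists (L * `|r| + `|grad F 0|) => x xr.
rewrite -[grad F x](subrK (grad F 0)) (le_trans (ler_normD _ _))// lerD2r.
rewrite (le_trans (smooth_grad_lipschitz _ _ sF))// subr0 ler_wpM2l//.
by rewrite (le_trans xr)// ler_norm.
Qed.

Lemma convex_grad_subdiff (k : R) (F : V -> R) x :
  (forall z, differentiable F z) -> convex_function setT F ->
  (forall x y, `|grad F x - grad F y| <= k * `|x - y|) ->
  subdiff F x (grad F x).
Proof.
move=> dF cF Fk z; rewrite -subr_ge0.
(* The [3 / 2] is [1 / 2] from the descent inequality from [x + t *: (z - x)] back to [x], plus [1]
   from replacing the gradient there by the one at [x]. *)
apply: (@affine_ge0_at0 _ _ (3 * k * `|z - x| ^+ 2 / 2)) => t /andP[t0 t1].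
have := @convex_functionE _ _ F z x t cF; rewrite t1 (ltW t0) => /(_ isT).
have -> : t *: z + (1 - t) *: x = x + t *: (z - x).
  by rewrite scalerBl scale1r scalerBr addrCA.
have := @lipschitz_grad_descent k F (x + t *: (z - x)) x dF Fk.
have xt : x - (x + t *: (z - x)) = - (t *: (z - x)) by rewrite opprD addNKr.
rewrite xt normrN normrZ (ger0_norm (ltW t0)) dotpNr dotpZr exprMn.
have : '[grad F x - grad F (x + t *: (z - x)), z - x] <= k * t * `|z - x| ^+ 2.
  apply: le_trans (CauchySchwarz_dotp _ _) _.
  apply: le_trans (ler_wpM2r (normr_ge0 _) (Fk _ _)) _.
  by rewrite xt normrN normrZ (ger0_norm (ltW t0)); lra.
rewrite (dotpDl (grad F x)) dotpNl => /(ler_wpM2l (ltW t0)).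
rewrite -(pmulr_rge0 _ t0).
move: '[grad F x, z - x] '[grad F _, z - x] (F (x + _)) (`|z - x|) => p q c n.
by lra.
Qed.

End Gradients.

(** * Standing bounds *)

Section Backtracking.
Context {R : realType}.

(* Invariant: [i <= j] and [2 ^ j <= b * min (a, 2 ^ i)]. *)
Lemma visited_bound (feas desc : nat -> nat -> Prop) (a b : R) i j :
  2 <= a -> 2 <= b -> visited feas desc i j ->
  (forall i j, visited feas desc i j -> ~ feas i j -> 2 ^+ j.+1 <= b) ->
  (forall i j, visited feas desc i j -> feas i j -> ~ desc i j ->
     2 ^+ i.+1 <= a \/ 2 ^+ j.+1 <= b) ->
  2 ^+ i <= a * b /\ 2 ^+ j <= a * b.
Proof.
move=> a2 b2 vis hfeas hdesc.
suff [ij [j1 j2]] : (i <= j)%N /\ (2 ^+ j <= b * 2 ^+ i /\ 2 ^+ j <= b * a :> R).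
  rewrite mulrC; split=> //; apply: le_trans j2.
  by rewrite ler_weXn2l// ler1n.
have le_mul (c : R) n : c <= b -> c <= b * 2 ^+ n /\ c <= b * a.
  move=> cb; have n1 : 1 <= 2 ^+ n :> R by rewrite exprn_ege1// ler1n.
  by split; nra.
elim: vis => {i j} [|i j vis [ij [j1 j2]] Nf|i j vis [ij [j1 j2]] f Nd].
- by split=> //; apply: (le_mul _ 0%N); rewrite expr0; lra.
- by split; [exact: leqW|apply/le_mul/hfeas/Nf].
(* When [i] was too small, [j] doubles along with it, so only [2 ^+ j.+1 <= b * 2 ^+ i.+1 <= b * a]
   survives; hence the product of two maxima in [M_L]. *)
- split=> //; have [h|h] := hdesc _ _ vis f Nd; last exact: le_mul.
  by move: h; rewrite !exprS; split; nra.
Qed.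

End Backtracking.

Section Problem.
Context {R : realType} {X Y : finHilbertType R} (D : sMBA_data X Y).
Context (hA : assumption_A D) (hbase : compact_base D).

Local Notation G := (conG D).
Local Notation B := (baseB D).
Local Notation Omega := (Omega0 D).

Lemma Lf_gt0 : 0 < Lf D. Proof. by case: hA => _ []. Qed.
Lemma LG_ge0 : 0 <= LG D. Proof. by case: hA => _ []. Qed.
Lemma smooth_objf : smooth (Lf D) (objf D). Proof. by case: hA => _ []. Qed.
Lemma smooth_conG : smooth (LG D) G. Proof. by case: hA => _ []. Qed.

Lemma differentiable_conG x : differentiable G x.
Proof. by case: smooth_conG => -[]. Qed.

Lemma Omega0_bounded : exists r, forall x, Omega x -> `|x| <= r.
Proof. by case: hA => _ _ _ [_ /bounded_setP]. Qed.

Lemma x0_Omega0 : Omega (x0 D).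
Proof.
split=> //=; case: hA => _ _ _ [+ _] _; exact: interior_subset.
Qed.

Lemma baseB_nonempty : B !=set0.
Proof.
case: hbase => _ [_ _ polarE].
have : polar (coneK D) 0 by move=> w _; rewrite dotp0l.
by rewrite polarE => -[t _ [d Bd _]]; exists d.
Qed.

Lemma baseB_bounded : bounded_set B.
Proof. by case: hbase => /compact_bounded. Qed.

Lemma baseB_polar u : B u -> polar (coneK D) u.
Proof.
by case: hbase => _ [_ _ ->] Bu; exists 1 => //=; exists u; rewrite ?scale1r.
Qed.

Lemma polarZ t u : 0 <= t -> polar (coneK D) u -> polar (coneK D) (t *: u).
Proof. by move=> t0 pu w /pu; rewrite dotpZl; exact: mulr_ge0_le0. Qed.

(** A supremum in [R] of an unbounded set is 0, so this and the similar bounds by [M_G], [M_f],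
    [M_P1], [M_P2], [M_G_hat] must first exhibit an upper bound: here by compactness of the base,
    there by boundedness of the region. *)
Lemma norm_le_M_B u : B u -> `|u| <= M_B D.
Proof.
have /bounded_setP[M BM] := baseB_bounded.
by move=> Bu; apply: ub_le_sup; [exists M => _ [v /BM ? <-]|exists u].
Qed.

Lemma M_B_ge0 : 0 <= M_B D.
Proof. by have [u /norm_le_M_B] := baseB_nonempty; exact: le_trans. Qed.

Lemma opnorm_DG_ge0 x : 0 <= opnorm (DG D x).
Proof. by apply: opnorm_ge0; exact: linearP. Qed.

Lemma opnorm_DG_le_M_G x : Omega x -> opnorm (DG D x) <= M_G D.
Proof.
move=> Ox; have [r Or] := Omega0_bounded.
have [C _ CP] := smooth_opnorm_bounded r LG_ge0 smooth_conG.
by apply: ub_le_sup; [exists C => _ [z /Or/CP ? <-]|exists x].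
Qed.

Lemma M_G_ge0 : 0 <= M_G D.
Proof. exact: le_trans (opnorm_DG_ge0 _) (opnorm_DG_le_M_G x0_Omega0). Qed.

Lemma gB_star_le x : Omega x -> gB_star D <= gB D x.
Proof.
move=> Ox; have [r Or] := Omega0_bounded.
have [C CP] := smooth_norm_bounded r LG_ge0 smooth_conG.
apply: ge_inf; last by exists x.
have [u Bu] := baseB_nonempty.
exists (- (C * M_B D)) => _ [z /Or/CP zC <-].
apply: le_trans (support_ub _ baseB_bounded Bu).
rewrite lerNl (le_trans (ler_norm _))// normrN (le_trans (normr_dotp _ _))//.
by rewrite ler_pM// norm_le_M_B.
Qed.

Lemma norm_grad_le_M_f x : Omega x -> `|grad (objf D) x| <= M_f D.
Proof.
move=> Ox; have [r Or] := Omega0_bounded.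
have [C CP] := smooth_grad_bounded r (ltW Lf_gt0) smooth_objf.
by apply: ub_le_sup; [exists C => _ [z /Or/CP ? <-]|exists x].
Qed.

Lemma norm_subdiff_le_M_P2 x xi : Omega x -> subdiff (P2 D) x xi -> `|xi| <= M_P2 D.
Proof.
move=> Ox xiP; have [r Or] := Omega0_bounded.
have [C CP] : exists C, forall x z, `|x| <= r -> subdiff (P2 D) x z -> `|z| <= C.
  by case: hA => _ _ [_ /subdiff_bounded].
apply: ub_le_sup; last by exists xi => //; exists x.
by exists C => _ [z [y /Or yr /(CP _ _ yr) ?] <-].
Qed.

Lemma M_R_ge0 mu0 : 0 <= mu0 -> 0 < Lcheck D -> 0 <= M_R D mu0.
Proof.
move=> m0 L0; rewrite addr_ge0// !mulr_ge0 ?M_G_ge0 ?M_B_ge0//.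
by rewrite invr_ge0 ltW.
Qed.

Lemma Omega0_hat_bounded mu0 :
  exists r, forall x, Omega0_hat D mu0 x -> `|x| <= r.
Proof.
have [r Or] := Omega0_bounded; exists (r + M_R D mu0) => _ [a /Or ar [b + <-]].
by rewrite /= /closed_ball_ /= sub0r normrN => bM;
  rewrite (le_trans (ler_normD _ _))// lerD.
Qed.

Lemma Omega0_hatP mu0 x y :
  Omega x -> `|y - x| <= M_R D mu0 -> Omega0_hat D mu0 y.
Proof.
move=> Ox yx; exists x => //; exists (y - x); last by rewrite addrC subrK.
by rewrite /= /closed_ball_ /= sub0r normrN.
Qed.

Lemma norm_subdiff_le_M_P1 mu0 x z :
  Omega0_hat D mu0 x -> subdiff (P1 D) x z -> `|z| <= M_P1 D mu0.
Proof.
move=> Ox zP; have [r Or] := Omega0_hat_bounded mu0.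
have [C CP] : exists C, forall x z, `|x| <= r -> subdiff (P1 D) x z -> `|z| <= C.
  by case: hA => _ _ [/subdiff_bounded].
apply: ub_le_sup; last by exists z => //; exists x.
by exists C => _ [w [y /Or yr /(CP _ _ yr) ?] <-].
Qed.

Lemma opnorm_DG_le_M_G_hat mu0 x :
  conv_hull (Omega0_hat D mu0) x -> opnorm (DG D x) <= M_G_hat D mu0.
Proof.
have [r Or] := Omega0_hat_bounded mu0.
have hull_r z : conv_hull (Omega0_hat D mu0) z -> `|z| <= r.
  move=> /(_ [set w | `|w| <= r]); apply; split=> [u v t|u /Or//];
    rewrite !inE /= => ur vr.
  have t0 : 0 <= t%:num by []. have t1 : 0 <= 1 - t%:num by rewrite subr_ge0.
  rewrite (le_trans (ler_normD _ _))// !normrZ (ger0_norm t0) (ger0_norm t1); nra.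
have [C _ CP] := smooth_opnorm_bounded r LG_ge0 smooth_conG.
by move=> Hx; apply: ub_le_sup; [exists C => _ [z /hull_r/CP ? <-]|exists x].
Qed.

Lemma segment_conv_hull (A : set X) x y (t : R) :
  A x -> A y -> 0 <= t <= 1 -> conv_hull A (x + t *: (y - x)).
Proof.
move=> Ax Ay t01 S [cS AS].
have -> : x + t *: (y - x) = t *: y + (1 - t) *: x.
  by rewrite scalerBl scale1r scalerBr addrCA.
by apply: convex_setE => //; exact: AS.
Qed.

(* Outside [Omega0 D] the objective exceeds its value at [x0 D], and on the
   bounded set [Omega0 D] it is bounded. *)
Lemma psi_star_le x : feasible D x -> psi_star D <= psi D x.
Proof.
move=> Fx; apply: ge_inf; last by exists x.
have [r Or] := Omega0_bounded.
case: hA => _ _ [cP1 cP2] _ _.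
have [C1 C1P] := convex_function_bounded r cP1.
have [C2 C2P] := convex_function_bounded r cP2.
have [Cg CgP] := smooth_grad_bounded r (ltW Lf_gt0) smooth_objf.
exists (Num.min (psi D (x0 D))
  (objf D 0 - (Cg * `|r| + Lf D * `|r| ^+ 2 / 2) - C1 - C2)) => _ [z Fz <-].
have [zle|/ltW zge] := leP (psi D z) (psi D (x0 D)); last by rewrite ge_min zge.
have zr := Or z (conj zle Fz).
rewrite ge_min; apply/orP; right; rewrite /psi.
have := C1P _ zr; have := C2P _ zr; rewrite !ler_norml => /andP[_ ?] /andP[? _].
(* The descent inequality from [z] to the origin, read as a lower bound on [objf D z]. *)
have := smooth_descent z 0 smooth_objf; rewrite sub0r normrN dotpNr.
have zr' : `|z| <= `|r| by exact: le_trans (ler_norm r).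
have : - '[grad (objf D) z, z] <= Cg * `|r|.
  rewrite (le_trans (ler_norm _))// normrN (le_trans (normr_dotp _ _))//.
  by rewrite ler_pM// CgP.
have : Lf D * `|z| ^+ 2 <= Lf D * `|r| ^+ 2.
  by rewrite ler_wpM2l ?(ltW Lf_gt0)// lerXn2r ?nnegrE.
by lra.
Qed.

End Problem.

(** * The smoothing functions *)

Section Smoothing.
Context {R : realType} {X Y : finHilbertType R} (D : sMBA_data X Y).
Context (hA : assumption_A D) (hbase : compact_base D) (hB : assumption_B D).

Local Notation G := (conG D).
Local Notation B := (baseB D).
Local Notation Omega := (Omega0 D).

Lemma alpha1_ge0 : 0 <= alpha1 D. Proof. by case: hB => -[]. Qed.
Lemma alpha2_gt0 : 0 < alpha2 D. Proof. by case: hB => -[]. Qed.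
Lemma alpha3_gt0 : 0 < alpha3 D. Proof. by case: hB => -[]. Qed.
Lemma alpha4_gt0 : 0 < alpha4 D. Proof. by case: hB => -[]. Qed.

Lemma differentiable_hmu mu y : 0 < mu -> differentiable (hmu D mu) y.
Proof. by case: hB => _ h _ /h[_ []]. Qed.

Lemma hmu_grad_lipschitz mu y z : 0 < mu ->
  `|grad (hmu D mu) y - grad (hmu D mu) z| <= (alpha1 D + alpha2 D / mu) * `|y - z|.
Proof. by case: hB => _ h _ /h[_ _ hl _]; exact: (hl (y, z)). Qed.

Lemma hmu_bounds mu y : 0 < mu ->
  support B y <= hmu D mu y <= support B y + alpha3 D * mu.
Proof. by case: hB => _ h _ /h[]. Qed.

Lemma subdiff_hmu mu y : 0 < mu ->
  subdiff (hmu D mu) y (grad (hmu D mu) y).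
Proof.
move=> m0; have [_ /(_ _ m0)[cvx _ _ _] _] := hB.
apply: convex_grad_subdiff => // [z|u v]; first exact: differentiable_hmu.
exact: hmu_grad_lipschitz.
Qed.

Lemma grad_hmu_baseB mu y : 0 < mu -> B (grad (hmu D mu) y).
Proof.
move=> m0; case: (hbase) => cB [cvB _ _].
apply: (subdiff_support (c := alpha3 D * mu) cB cvB (baseB_nonempty hbase) _
  (subdiff_hmu y m0)).
by move=> z; case/andP: (hmu_bounds z m0).
Qed.

Lemma gmu_antitone mu1 mu0 x : 0 < mu1 -> mu1 < mu0 ->
  gmu D mu1 x <= gmu D mu0 x - alpha4 D * (mu0 - mu1).
Proof. by case: hB => _ _; apply. Qed.

Lemma feasible_of_gmu_le0 mu x : 0 < mu -> gmu D mu x <= 0 -> feasible D x.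
Proof.
move=> m0 gx; case: (hA) => -[clK cvK coneK _ [k /interior_subset Kk]] _ _ _ _.
case: (hbase) => _ baseP.
apply: (mem_cone_of_support_le0 clK cvK coneK _ (baseB_bounded hbase) baseP);
  first by exists k.
by have /andP[h _] := hmu_bounds (G x) m0; apply: le_trans h gx.
Qed.

Lemma grad_gmuE mu x v : 0 < mu ->
  '[grad (gmu D mu) x, v] = '[grad (hmu D mu) (G x), DG D x v].
Proof.
move=> m0; apply: grad_comp; first exact: differentiable_conG.
exact: differentiable_hmu.
Qed.

Lemma grad_gmu_adjoint mu x : 0 < mu ->
  grad (gmu D mu) x = adjoint (DG D x) (grad (hmu D mu) (G x)).
Proof.
move=> m0; apply: dotp_inj => v.
by rewrite grad_gmuE// adjointE; [rewrite dotpC|exact: linearP].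
Qed.

Lemma norm_grad_gmu_le mu x : 0 < mu -> Omega x ->
  `|grad (gmu D mu) x| <= M_G D * M_B D.
Proof.
move=> m0 Ox; set g := grad _ _; have [g0|g0] := eqVneq g 0.
  by rewrite g0 normr0 mulr_ge0 ?(M_G_ge0 hA) ?(M_B_ge0 hbase).
rewrite -(ler_pM2r (x := `|g|)) ?normr_gt0// -expr2 -dotp_norm {1}/g grad_gmuE//.
apply: le_trans (CauchySchwarz_dotp _ _) _.
rewrite mulrC mulrAC ler_pM//; last exact/(norm_le_M_B hbase)/grad_hmu_baseB.
apply: le_trans (opnorm_ub _ _) _; first exact: linearP.
by rewrite ler_wpM2r// (opnorm_DG_le_M_G hA).
Qed.

(* The subgradient inequality at [y], tested at [0] where the support function
   vanishes. *)
Lemma hmu_le_dotp_grad mu y : 0 < mu ->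
  hmu D mu y - alpha3 D * mu <= '[grad (hmu D mu) y, y].
Proof.
move=> m0; have := subdiff_hmu y m0 0; rewrite sub0r dotpNr.
have /andP[_] := hmu_bounds 0 m0.
have : support B 0 <= 0.
  by apply: support_le => [|u _]; [exact: baseB_nonempty|rewrite dotp0l].
by lra.
Qed.

Lemma M_G_hat_ge0 mu0 : 0 <= mu0 -> 0 < Lcheck D -> 0 <= M_G_hat D mu0.
Proof.
move=> m0 L0.
have Ox0 := x0_Omega0 hA.
have Hx0 : Omega0_hat D mu0 (x0 D).
  by apply: (Omega0_hatP Ox0); rewrite subrr normr0 (M_R_ge0 hA hbase).
apply: le_trans (opnorm_DG_ge0 D (x0 D)) _.
by apply: (opnorm_DG_le_M_G_hat hA) => S [_]; apply.
Qed.

Lemma L_mu_ge0 mu0 mu : 0 < mu -> 0 <= L_mu D mu0 mu.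
Proof.
move=> m_gt0; rewrite /L_mu; move: (M_G_hat D mu0 ^+ 2) (sqr_ge0 (M_G_hat D mu0))
  => s s0.
by rewrite !(addr_ge0, mulr_ge0)// ?(M_B_ge0 hbase) ?(LG_ge0 hA) ?alpha1_ge0
  ?(ltW alpha2_gt0) ?invr_ge0 ?(ltW m_gt0).
Qed.

(** The factor [mu] cancels the [1 / mu] of the smoothing term, so one threshold on the trial
    constant serves every [mu <= mu0]. The division of [L] by [mu] in [g_model] matches this
    scaling. *)
Lemma mulr_L_mu_le mu0 mu : 0 < mu <= mu0 ->
  mu * L_mu D mu0 mu <= mu0 * L_mu D mu0 mu0.
Proof.
move=> /andP[m m0]; have mu0_gt0 := lt_le_trans m m0.
have h : mu * L_mu D mu0 mu = mu * (M_B D * LG D + alpha1 D * M_G_hat D mu0 ^+ 2)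
    + alpha2 D * M_G_hat D mu0 ^+ 2.
  by rewrite /L_mu; field; rewrite gt_eqF.
have h0 : mu0 * L_mu D mu0 mu0 = mu0 * (M_B D * LG D + alpha1 D * M_G_hat D mu0 ^+ 2)
    + alpha2 D * M_G_hat D mu0 ^+ 2.
  by rewrite /L_mu; field; rewrite gt_eqF.
rewrite h h0 lerD2r ler_wpM2r// addr_ge0//.
  by rewrite mulr_ge0 ?(M_B_ge0 hbase) ?(LG_ge0 hA).
by rewrite mulr_ge0 ?alpha1_ge0 ?sqr_ge0.
Qed.

(** Two descent inequalities in a row: for [hmu D mu] from [G x] to [G y], then for the pairing of
    [G] with [u]. The second yields [M_B * LG]; the first costs [|G y - G x| ^ 2], which [M_G_hat]
    bounds because the convex hull contains the segment from [x] to [y]. *)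
Lemma gmu_descent mu0 mu x y : 0 < mu <= mu0 -> 0 < Lcheck D ->
  Omega x -> Omega0_hat D mu0 y ->
  gmu D mu y <= gmu D mu x + '[grad (gmu D mu) x, y - x]
                + L_mu D mu0 mu * `|y - x| ^+ 2 / 2.
Proof.
move=> /andP[m m0] L0 Ox Oy; rewrite /gmu.
set h := hmu D mu; set u := grad h (G x).
have sG := smooth_conG hA.
have Gyx : `|G y - G x| <= M_G_hat D mu0 * `|y - x|.
  apply: norm_diff_le => [z|t t01]; first exact: differentiable_conG.
  apply: (opnorm_DG_le_M_G_hat hA); apply: segment_conv_hull => //.
  apply: (Omega0_hatP Ox); rewrite subrr normr0.
  by rewrite (M_R_ge0 hA hbase)// (le_trans (ltW m)).
have dh z : differentiable h z by exact: differentiable_hmu.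
have hL y1 y2 := hmu_grad_lipschitz y1 y2 m.
have h1 := lipschitz_grad_descent (G x) (G y) dh hL.
have h2 := smooth_dotp_descent x y u sG.
have uM : `|u| <= M_B D by exact/(norm_le_M_B hbase)/grad_hmu_baseB.
have k0 : 0 <= alpha1 D + alpha2 D / mu.
  by rewrite addr_ge0 ?alpha1_ge0// divr_ge0// ltW// alpha2_gt0.
have h3 : (alpha1 D + alpha2 D / mu) * `|G y - G x| ^+ 2
    <= (alpha1 D + alpha2 D / mu) * (M_G_hat D mu0 ^+ 2 * `|y - x| ^+ 2).
  rewrite ler_wpM2l// -exprMn lerXn2r ?nnegrE//.
  by rewrite mulr_ge0// M_G_hat_ge0// (le_trans (ltW m)).
have h4 : `|u| * LG D * `|y - x| ^+ 2 <= M_B D * LG D * `|y - x| ^+ 2.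
  by rewrite ler_wpM2r ?exprn_ge0// ler_wpM2r// (LG_ge0 hA).
have h5 : '[grad (gmu D mu) x, y - x] = '[u, 'd G x (y - x)] by exact: grad_gmuE.
have h6 : '[u, G y - G x] = '[u, G y] - '[u, G x] by rewrite dotpDr dotpNr.
rewrite -/h -/u h6 in h1; rewrite h5 /L_mu.
by lra.
Qed.

End Smoothing.

(** * Trial points and multipliers *)

Section Trial.
Context {R : realType} {X Y : finHilbertType R} (D : sMBA_data X Y).
Context (hA : assumption_A D) (hbase : compact_base D) (hB : assumption_B D).
Context (Lcheck_gt0 : 0 < Lcheck D).

Local Notation Omega := (Omega0 D).
Implicit Types (mu lam L : R) (x y : X).

Lemma subdiff_min_quadratic (P : X -> R) (a x y : X) (c : R) :
  convex_function setT P ->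
  (forall z, P y + '[a, y - x] + c / 2 * `|y - x| ^+ 2
             <= P z + '[a, z - x] + c / 2 * `|z - x| ^+ 2) ->
  subdiff P y (- (a + c *: (y - x))).
Proof.
move=> cP ymin z; rewrite -subr_ge0.
apply: (@affine_ge0_at0 _ _ (c / 2 * `|z - y| ^+ 2)) => t /andP[t0 t1].
have := @convex_functionE _ _ P z y t cP; rewrite t1 (ltW t0) => /(_ isT).
have := ymin (t *: z + (1 - t) *: y).
have -> : t *: z + (1 - t) *: y - x = (y - x) + t *: (z - y).
  rewrite scalerBl scale1r scalerBr [RHS]addrACA [in LHS]addrA -[LHS]addrA.
  by congr (_ + _); rewrite addrC.
rewrite (normD_sqr (y - x)) normrZ (ger0_norm (ltW t0)) exprMn.
rewrite dotpNl (dotpDl a) dotpZl (dotpDr (y - x)) !dotpZr => h1 h2.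
rewrite -(pmulr_rge0 _ t0); nra.
Qed.

(** With [s = mu0 / Lcheck D] and [L / mu >= 1 / s], the model constraint becomes a quadratic
    inequality in [n = |y - x|], namely [n ^ 2 - 2 * s * q * n + 2 * s * gB_star <= 0]; [M_R] is its
    larger root. *)
Lemma trial_Omega0_hat (mu0 mu : R) x L y : 0 < mu <= mu0 -> Omega x ->
  Lcheck D <= L -> g_model D mu x L y <= 0 -> Omega0_hat D mu0 y.
Proof.
move=> /andP[m m0] Ox LL; rewrite /g_model => gy; apply: (Omega0_hatP Ox).
set n := `|y - x| in gy *.
have mu0_gt0 := lt_le_trans m m0; have L_gt0 := lt_le_trans Lcheck_gt0 LL.
pose s := mu0 / Lcheck D; pose q := M_G D * M_B D.
have s0 : 0 < s by rewrite divr_gt0.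
have h1 : - (q * n) <= '[grad (gmu D mu) x, y - x].
  rewrite lerNl -dotpNl (le_trans (CauchySchwarz_dotp _ _))// normrN ler_wpM2r//.
  exact: norm_grad_gmu_le.
have h2 : gB_star D <= gmu D mu x.
  apply: le_trans (gB_star_le hA hbase Ox) _.
  by case/andP: (hmu_bounds hB (conG D x) m).
have h3 : n ^+ 2 <= 2 * s * (L / (2 * mu) * n ^+ 2).
  rewrite mulrA ler_peMl ?sqr_ge0//.
  have -> : 2 * s * (L / (2 * mu)) = (mu0 / mu) * (L / Lcheck D).
    by rewrite /s; field; rewrite !gt_eqF.
  by apply: mulr_ege1; rewrite ler_pdivlMr// mul1r.
have h4 : (n - s * q) ^+ 2 <= s ^+ 2 * q ^+ 2 - 2 * s * gB_star D.
  have : 2 * s * (gB_star D - q * n + L / (2 * mu) * n ^+ 2) <= 0.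
    rewrite pmulr_rle0; last by rewrite mulr_gt0.
    by apply: le_trans gy; rewrite lerD2r lerD.
  by lra.
have -> : M_R D mu0 = Num.sqrt (s ^+ 2 * q ^+ 2 - 2 * s * gB_star D) + s * q.
  rewrite /M_R /s /q !exprMn exprVn; congr (Num.sqrt _ + _); ring.
rewrite -lerBlDr (le_trans (ler_norm _))// -sqrtr_sqr ler_wsqrtr//.
Qed.

Lemma trial_feasible (mu0 mu : R) x L y : 0 < mu <= mu0 -> Omega x ->
  Lcheck D <= L -> mu0 * L_mu D mu0 mu0 <= L -> g_model D mu x L y <= 0 ->
  gmu D mu y <= 0.
Proof.
move=> m Ox LL LmuL gy; have Oy := trial_Omega0_hat m Ox LL gy.
have := gmu_descent hA hbase hB m Lcheck_gt0 Ox Oy.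
have := mulr_L_mu_le hA hbase hB m.
move: gy m; rewrite /g_model; set n := `|y - x| => gy /andP[m _] h1 h2.
have h3 : L_mu D mu0 mu * n ^+ 2 / 2 <= L / (2 * mu) * n ^+ 2.
  rewrite mulrAC ler_wpM2r ?sqr_ge0// invfM mulrA [L / 2]mulrC -mulrA [leLHS]mulrC.
  by rewrite ler_wpM2l ?invr_ge0// ler_pdivlMr// mulrC (le_trans h1).
by apply: le_trans h2 _; apply: le_trans _ gy; rewrite lerD2l.
Qed.

Lemma multiplier_subdiff mu x xi Lf' Lg' y lam : 0 < mu ->
  multiplier (psi_model D x xi Lf') (g_model D mu x Lg') y lam ->
  subdiff (P1 D) y (- (grad (objf D) x - xi + Lf' *: (y - x)
      + lam *: (grad (gmu D mu) x + (Lg' / mu) *: (y - x)))).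
Proof.
move=> m [lam0 _ ymin]; set g := grad (gmu D mu) x.
have cP1 : convex_function setT (P1 D) by case: (hA) => _ _ [].
have := @subdiff_min_quadratic _ (grad (objf D) x - xi + lam *: g) x y
  (Lf' + lam * (Lg' / mu)) cP1.
have -> : grad (objf D) x - xi + lam *: g + (Lf' + lam * (Lg' / mu)) *: (y - x) =
    grad (objf D) x - xi + Lf' *: (y - x) + lam *: (g + (Lg' / mu) *: (y - x)).
  by rewrite scalerDl [lam *: (_ + _)]scalerDr scalerA [LHS]addrACA.
apply=> z.
have := ymin z; rewrite /psi_model /g_model -/g.
rewrite !(dotpDl _ (lam *: g)) !dotpZl invfM => h; lra.
Qed.

(** Testing the subgradient of [P1] at [y] against [x] produces [lam * Lg' / mu * |y - x| ^ 2], and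
    complementarity with [gmu D mu x <= 0] takes back at most half of it. The rest covers the [tau2]
    term, while [Lf'] covers the curvature of [f] and the [tau1] term. *)
Lemma trial_descent mu x xi Lf' Lg' y lam : 0 < mu ->
  subdiff (P2 D) x xi -> gmu D mu x <= 0 ->
  Lf D + tau1 D <= Lf' -> 0 <= Lf' -> tau2 D <= Lg' ->
  multiplier (psi_model D x xi Lf') (g_model D mu x Lg') y lam ->
  psi D y <= psi D x - (tau1 D * mu + tau2 D * lam) / (2 * mu) * `|y - x| ^+ 2.
Proof.
move=> m xiP gx Lf'L Lf'0 Lg'L mult.
have := multiplier_subdiff m mult x; case: mult => lam0 compl _.
have := xiP y; have := smooth_descent x y (smooth_objf hA); rewrite /psi.
move: compl; rewrite /g_model.
have -> : x - y = - (y - x) by rewrite opprB.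
move: (grad (gmu D mu) x) (grad (objf D) x) (y - x) => g p d.
rewrite !dotpE (dotp_norm d); have n0 : 0 <= `|d| ^+ 2 by exact: sqr_ge0.
move: (`|d| ^+ 2) n0 => n n0 compl h1 h2 h3.
have m2 : (2 * mu)^-1 = mu^-1 / 2 by rewrite invfM mulrC.
have lgx : lam * gmu D mu x <= 0 by rewrite mulr_ge0_le0.
have -> : (tau1 D * mu + tau2 D * lam) / (2 * mu) = tau1 D / 2 + lam * (tau2 D /
  mu / 2).
  by field; rewrite gt_eqF.
have h4 : lam * (tau2 D / mu * n) <= lam * (Lg' / mu * n).
  by rewrite ler_wpM2l// ler_wpM2r// ler_pM2r ?invr_gt0.
have h5 : (Lf D + tau1 D) * n <= Lf' * n by rewrite ler_wpM2r.
have h6 : 0 <= Lf' * n by rewrite mulr_ge0.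
have h7 : lam * (Lg' / (2 * mu) * n) = lam * (Lg' / mu * n) / 2.
  by field; rewrite gt_eqF.
rewrite !mulrDr h7 in compl.
lra.
Qed.

End Trial.

(** * Bounds on the backtracking constants and on the multiplier *)

Section Step.
Context {R : realType} {X Y : finHilbertType R} (D : sMBA_data X Y).
Context (hA : assumption_A D) (hbase : compact_base D) (hB : assumption_B D).
Context (tau1_gt0 : 0 < tau1 D) (tau2_gt0 : 0 < tau2 D).
Context (Lcheck_gt0 : 0 < Lcheck D) (Lcheck_le : Lcheck D <= Lhat D).

Local Notation Omega := (Omega0 D).
Implicit Types (lam : R) (x y xi : X).

(** Besides the trial constants, [M_L] has to dominate the curvature of the data, here [Lf D] and
    below [mu * (LG D * M_B D)]: then one constant bounds all four terms of the KKT residual. *)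
Lemma Lf_le_M_L (mu0 : R) : Lf D <= M_L D mu0.
Proof.
rewrite /M_L; set a := Num.max _ _; set b := Num.max _ _.
have a1 : 2 * (Lf D + tau1 D) <= Lcheck D * a.
  by rewrite [leRHS]mulrC -ler_pdivrMr// /a le_max lexx orbT.
have b1 : 2 <= b by rewrite /b le_max lexx.
have a0 : 0 <= a by rewrite /a le_max ler0n.
have h1 : Lcheck D * a <= Lhat D * a by rewrite ler_wpM2r.
have h2 : Lhat D * a <= Lhat D * a * b.
  rewrite ler_peMr ?(le_trans _ b1) ?ler1n//.
  by rewrite mulr_ge0// (le_trans (ltW Lcheck_gt0)).
have := Lf_gt0 hA; have := tau1_gt0; lra.
Qed.

Lemma M_L_gt0 (mu0 : R) : 0 < M_L D mu0.
Proof. exact: lt_le_trans (Lf_gt0 hA) (Lf_le_M_L mu0). Qed.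

Lemma LG_M_B_le_M_L (mu0 mu : R) : 0 < mu <= mu0 -> mu * (LG D * M_B D) <= M_L D mu0.
Proof.
move=> /andP[m m0]; have mu0_gt0 := lt_le_trans m m0.
apply: (@le_trans _ _ (mu0 * L_mu D mu0 mu0)).
  apply: ler_pM => //; first exact: ltW.
    by rewrite mulr_ge0 ?(LG_ge0 hA) ?(M_B_ge0 hbase).
  rewrite /L_mu mulrC -addrA lerDl.
  move: (M_G_hat D mu0 ^+ 2) (sqr_ge0 (M_G_hat D mu0)) => s s0.
  by rewrite !(addr_ge0, mulr_ge0)// ?(alpha1_ge0 hB) ?(ltW (alpha2_gt0 hB))
    ?invr_ge0 ?(ltW mu0_gt0).
rewrite /M_L; set a := Num.max _ _; set b := Num.max _ _.
have a2 : 2 <= a by rewrite /a le_max lexx.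
have b1 : 2 * mu0 * L_mu D mu0 mu0 <= Lcheck D * b.
  by rewrite [leRHS]mulrC -ler_pdivrMr// /b !le_max lexx !orbT.
have b0 : 0 <= b by rewrite /b le_max ler0n.
have h1 : Lcheck D * b <= Lhat D * b by rewrite ler_wpM2r.
have h2 : 0 <= Lhat D * b by rewrite mulr_ge0// (le_trans (ltW Lcheck_gt0)).
have h3 : Lhat D * b <= Lhat D * b * a.
  by rewrite ler_peMr ?(le_trans _ a2) ?ler1n.
have : 0 <= mu0 * L_mu D mu0 mu0 by rewrite mulr_ge0 ?(L_mu_ge0 hA hbase hB) ?ltW.
rewrite (mulrAC _ a); lra.
Qed.

(** A test fails only while a constant is below its threshold: [mu0 * L_mu D mu0 mu0] for
    feasibility, [Lf D + tau1 D] or [tau2 D] for descent. The failing constant is the one before the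
    next doubling, whence the factors 2 in [a] and [b]; the start at or above [Lcheck D] explains
    the quotients. *)
Lemma backtracking_le_M_L (mu0 mu : R) x xi (Lf0 Lg0 : R)
    (xt : nat -> nat -> X) (lam : nat -> nat -> R)
    (feas := fun i j => gmu D mu (xt i j) <= 0 : Prop)
    (desc := fun i j => psi D (xt i j) <= psi D x
       - (tau1 D * mu + tau2 D * lam i j) / (2 * mu) * `|xt i j - x| ^+ 2 : Prop)
         i j :
  0 < mu <= mu0 -> Omega x -> gmu D mu x <= 0 -> subdiff (P2 D) x xi ->
  Lcheck D <= Lf0 <= Lhat D -> Lcheck D <= Lg0 <= Lhat D ->
  (forall i j, visited feas desc i j ->
     g_model D mu x (2 ^+ j * Lg0) (xt i j) <= 0 /\
     multiplier (psi_model D x xi (2 ^+ i * Lf0)) (g_model D mu x (2 ^+ j * Lg0))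
       (xt i j) (lam i j)) ->
  visited feas desc i j ->
  2 ^+ i * Lf0 <= M_L D mu0 /\ 2 ^+ j * Lg0 <= M_L D mu0.
Proof.
move=> mm0 Ox gx xiP /andP[Lf0l Lf0u] /andP[Lg0l Lg0u] trial vis.
have /andP[m _] := mm0.
set a := Num.max 2 (2 * (Lf D + tau1 D) / Lcheck D).
set b := Num.max 2 (Num.max (2 * tau2 D / Lcheck D)
                       (2 * mu0 * L_mu D mu0 mu0 / Lcheck D)).
have pow1 n : 1 <= 2 ^+ n :> R by rewrite exprn_ege1// ler1n.
have scale n (L c : R) : Lcheck D <= L -> 2 * c / Lcheck D <= 2 ^+ n.+1 -> c <= 2
  ^+ n * L.
  move=> LL; rewrite ler_pdivrMr// exprS => h.
  apply: (@le_trans _ _ (2 ^+ n * Lcheck D)); first by lra.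
  by rewrite ler_wpM2l// (le_trans _ (pow1 n)).
have Lge n (L : R) : Lcheck D <= L -> Lcheck D <= 2 ^+ n * L.
  move=> LL; rewrite (le_trans LL)// ler_peMl//.
  exact: le_trans (ltW Lcheck_gt0) LL.
have [||||ai bj] := visited_bound (a := a) (b := b) _ _ vis.
- by rewrite /a le_max lexx.
- by rewrite /b le_max lexx.
- move=> i' j' vis' Nf; rewrite leNgt; apply/negP => /ltW.
  rewrite /b !ge_max => /and3P[_ _ h]; apply: Nf.
  have [gy _] := trial _ _ vis'.
  apply: (trial_feasible hA hbase hB Lcheck_gt0 mm0 Ox (Lge j' _ Lg0l)) gy.
  by apply: scale => //; rewrite mulrA.
- move=> i' j' vis' f Nd; apply/orP; rewrite -[_ || _]negbK negb_or -!ltNge.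
  apply/negP => /andP[/ltW + /ltW]; rewrite /a /b !ge_max =>
    /andP[_ ha] /and3P[_ hb _].
  apply: Nd; have [_ mult] := trial _ _ vis'.
  apply: (trial_descent hA m xiP gx _ _ _ mult).
  + by apply: scale.
  + exact: le_trans (ltW Lcheck_gt0) (Lge _ _ Lf0l).
  + by apply: scale.
have ML c L : c <= a * b -> 0 <= c -> L <= Lhat D -> 0 <= L -> c * L <= M_L D mu0.
  move=> cab c0 LL L0; rewrite /M_L -/a -/b -mulrA [leRHS]mulrC.
  by rewrite ler_pM.
by split; apply: ML => //; rewrite ?exprn_ge0// (le_trans (ltW Lcheck_gt0)).
Qed.

(* Complementarity makes [|g + k d| ^ 2 = |g| ^ 2 - 2 k c]; pairing the
   stationarity equation with [g + k d] isolates [lam]. *)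
Lemma active_multiplier_le (V : finHilbertType R) (g d p : V)
    (lam k L M Q s c eb : R) :
  0 < k -> k^-1 <= s -> 0 <= lam -> 0 <= L -> `|g| ^+ 2 <= Q -> `|p| <= M ->
  c + '[g, d] + k / 2 * `|d| ^+ 2 = 0 ->
  0 < eb -> eb ^+ 2 <= `|g| ^+ 2 - 2 * k * c ->
  p + L *: d + lam *: (g + k *: d) = 0 ->
  lam <= M / eb + L * (s * Q / 4) / eb ^+ 2.
Proof.
move=> k0 ks lam0 L0 gQ pM compl eb0 ebg stat.
have gd : '[g, d] = - c - k / 2 * `|d| ^+ 2 by lra.
set w := g + k *: d in stat *.
have wE : `|w| ^+ 2 = `|g| ^+ 2 - 2 * k * c.
  rewrite /w (normD_sqr g) dotpZr normrZ (ger0_norm (ltW k0)) gd; lra.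
have ebw : eb <= `|w|.
  by rewrite -(@ler_pXn2r _ 2) ?nnegrE ?(ltW eb0)// wE.
have w0 : 0 < `|w| by exact: lt_le_trans ebw.
have Q0 : 0 <= Q by apply: le_trans gQ; exact: sqr_ge0.
have s0 : 0 <= s by apply: le_trans ks; rewrite invr_ge0 ltW.
have M0 : 0 <= M by exact: le_trans pM.
(* Completing the square in [k *: d + 2^-1 *: g] bounds this product with no estimate of [|d|]. *)
have dw : - '[d, w] <= s * Q / 4.
  have h1 : k * - '[d, w] <= `|g| ^+ 2 / 4.
    have := dotp_ge0 (k *: d + 2^-1 *: g).
    rewrite /w !dotpE (dotpC d g) (dotp_norm d) (dotp_norm g); lra.
  rewrite -ler_pdivlMl// in h1; apply: le_trans h1 _.
  rewrite -mulrA ler_pM// ?invr_ge0 ?(ltW k0)// ?divr_ge0 ?sqr_ge0//.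
  by rewrite ler_wpM2r// invr_ge0.
clearbody w; have lamw : lam * `|w| ^+ 2 <= M * `|w| + L * (s * Q / 4).
  have : '[p + L *: d + lam *: w, w] = 0 by rewrite stat dotp0l.
  rewrite !(dotpDl, dotpZl) (dotp_norm w) => h.
  have : - '[p, w] <= M * `|w|.
    rewrite -dotpNl (le_trans (CauchySchwarz_dotp _ _))// normrN.
    by rewrite ler_wpM2r.
  by have := ler_wpM2l L0 dw; lra.
rewrite (_ : lam = lam * `|w| ^+ 2 / `|w| ^+ 2); last by field; rewrite gt_eqF.
apply: (@le_trans _ _ (M / `|w| + L * (s * Q / 4) / `|w| ^+ 2)).
  rewrite (_ : M / `|w| = M * `|w| / `|w| ^+ 2); last by field; rewrite gt_eqF.
  by rewrite -mulrDl ler_wpM2r// invr_ge0 sqr_ge0.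
rewrite lerD//; first by rewrite ler_wpM2l// lef_pV2 ?posrE.
rewrite ler_wpM2l ?mulr_ge0 ?invr_ge0//.
by rewrite lef_pV2 ?posrE ?exprn_gt0// lerXn2r ?nnegrE// ltW.
Qed.

Lemma multiplier_le (mu0 mu : R) x xi (Lf' Lg' : R) y lam (eb : R) :
  0 < mu <= mu0 -> Omega x -> Omega y -> gmu D mu x <= 0 ->
  subdiff (P2 D) x xi -> 0 <= Lf' <= M_L D mu0 -> Lcheck D <= Lg' ->
  0 < eb -> eb ^+ 2 <= `|grad (gmu D mu) x| ^+ 2 - 2 * Lcheck D / mu * gmu D mu x ->
  multiplier (psi_model D x xi Lf') (g_model D mu x Lg') y lam ->
  lam <= (M_f D + M_P1 D mu0 + M_P2 D) / eb
         + M_L D mu0 * M_G D ^+ 2 * M_B D ^+ 2 * mu0 / (2 * Lcheck D * eb ^+ 2).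
Proof.
move=> /andP[m m0] Ox Oy gx xiP /andP[Lf0 LfM] LgL eb0 ebg mult.
have mu0_gt0 := lt_le_trans m m0.
have := multiplier_subdiff hA m mult; set g := grad (gmu D mu) x in ebg *.
set zeta := - _ => zetaP.
have fM := norm_grad_le_M_f hA Ox; have xiM := norm_subdiff_le_M_P2 hA Ox xiP.
have Oy' : Omega0_hat D mu0 y.
  by apply: (Omega0_hatP Oy); rewrite subrr normr0 (M_R_ge0 hA hbase)// ltW.
have zM := norm_subdiff_le_M_P1 hA Oy' zetaP.
have gM : `|g| <= M_G D * M_B D by exact: norm_grad_gmu_le.
set M := M_f D + M_P1 D mu0 + M_P2 D; set Q := (M_G D * M_B D) ^+ 2.
have M0 : 0 <= M.
  by rewrite !addr_ge0//; [apply: le_trans fM|apply: le_trans zM|apply: le_trans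
    xiM].
have -> : M_L D mu0 * M_G D ^+ 2 * M_B D ^+ 2 * mu0 / (2 * Lcheck D * eb ^+ 2)
    = M_L D mu0 * (mu0 / Lcheck D * Q / 2) / eb ^+ 2.
  by rewrite /Q; field; rewrite !gt_eqF.
have Q0 : 0 <= Q by exact: sqr_ge0.
have s0 : 0 <= mu0 / Lcheck D by rewrite divr_ge0 ?ltW.
have sQ0 : 0 <= mu0 / Lcheck D * Q by rewrite mulr_ge0.
case: mult => lam0 compl _.
(* For nonzero [lam], complementarity turns the model constraint into the equality at [y] that
   [active_multiplier_le] requires. *)
have [->|lam_n0] := eqVneq lam 0.
  rewrite addr_ge0//; first by rewrite divr_ge0// ltW.
  by rewrite divr_ge0 ?sqr_ge0// mulr_ge0 ?(ltW (M_L_gt0 _))// divr_ge0.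
move: compl => /eqP; rewrite mulf_eq0 (negbTE lam_n0)/= => /eqP;
  rewrite /g_model -/g => gy0.
have k0 : 0 < Lg' / mu by rewrite divr_gt0// (lt_le_trans Lcheck_gt0).
apply: (le_trans (@active_multiplier_le X g (y - x) (zeta + grad (objf D) x - xi)
   lam (Lg' / mu) Lf' M Q (mu0 / Lcheck D) (gmu D mu x) eb k0 _ lam0 Lf0 _ _ _
     eb0 _ _)).
- rewrite invf_div ler_pM ?invr_ge0 ?(ltW m)// ?lef_pV2 ?posrE//.
    by rewrite (le_trans (ltW Lcheck_gt0)).
  by rewrite (lt_le_trans Lcheck_gt0).
- by rewrite /Q lerXn2r ?nnegrE// (le_trans _ gM).
- have := ler_normB (zeta + grad (objf D) x) xi.
  have := ler_normD zeta (grad (objf D) x); rewrite /M => h1 h2.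
  apply: le_trans h2 _; apply: lerD xiM; apply: le_trans h1 _.
  by rewrite addrC lerD.
- rewrite -[RHS]gy0; congr (_ + _ * _); first by field; rewrite gt_eqF.
(* Since [gmu D mu x <= 0], passing from [Lcheck D] to the larger [Lg'] only increases the
   right-hand side. *)
- apply: le_trans ebg _; rewrite lerD2l lerN2 ler_wnM2r// -mulrA ler_wpM2l//.
  by rewrite ler_wpM2r// invr_ge0 ltW.
- rewrite /zeta; move: (grad (objf D) x) (Lf' *: (y - x)) (lam *: _) => a b c.
  by rewrite -!addrA addNr.
rewrite lerD2l ler_wpM2r ?invr_ge0 ?sqr_ge0// ler_pM ?divr_ge0//.
by rewrite ler_wpM2l// lef_pV2 ?posrE// ler_nat.
Qed.

End Step.

(** * KKT residual and complementarity at an accepted step *)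

Section ApproximateKKT.
Context {R : realType} {X Y : finHilbertType R} (D : sMBA_data X Y).
Context (hA : assumption_A D) (hbase : compact_base D) (hB : assumption_B D).
Context (tau1_gt0 : 0 < tau1 D) (tau2_gt0 : 0 < tau2 D).
Context (Lcheck_gt0 : 0 < Lcheck D) (Lcheck_le : Lcheck D <= Lhat D).

Implicit Types (lam : R) (x y xi : X).

Lemma adjoint_diff_le x y (u : Y) :
  `|adjoint (DG D y) u - adjoint (DG D x) u| <= LG D * `|y - x| * `|u|.
Proof.
set z := _ - _; have [->|z0] := eqVneq z 0.
  by rewrite normr0 !mulr_ge0 ?(LG_ge0 hA).
rewrite -(ler_pM2r (x := `|z|)) ?normr_gt0// -expr2 -dotp_norm.
rewrite {1}/z (dotpDl (adjoint _ _)) dotpNl !adjointE; try exact: linearP.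
rewrite -dotpNl -dotpDl (le_trans (CauchySchwarz_dotp _ _))//.
rewrite mulrAC ler_wpM2r//.
exact: (smooth_diffB _ _ _ (smooth_conG hA)).
Qed.

(** After cancellation four terms remain: the change of [grad f], [Lf' *: (y - x)], [lam] times the
    change of the adjoint applied to the fixed [u], and the quadratic part of the constraint model.
    Two are at most [M_L * |y - x|], two at most [lam / mu] times that. *)
Lemma KKT_residual_le (mu0 mu : R) x xi (Lf' Lg' : R) y lam
    (u := grad (hmu D mu) (conG D x)) :
  0 < mu <= mu0 -> 0 <= lam -> 0 <= Lf' <= M_L D mu0 -> 0 <= Lg' <= M_L D mu0 ->
  `|- (grad (objf D) x - xi + Lf' *: (y - x)
       + lam *: (grad (gmu D mu) x + (Lg' / mu) *: (y - x)))
    - xi + grad (objf D) y + adjoint (DG D y) (lam *: u)|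
  <= 2 * M_L D mu0 * (1 + lam / mu) * `|y - x|.
Proof.
move=> mm0 lam0 /andP[Lf0 LfM] /andP[Lg0 LgM]; have /andP[m m0] := mm0.
have uM : `|u| <= M_B D by exact/(norm_le_M_B hbase)/grad_hmu_baseB.
rewrite (grad_gmu_adjoint hA hB x m) -/u.
rewrite adjointZ; last exact: linearP.
have h1 := smooth_grad_lipschitz y x (smooth_objf hA).
have h2 := adjoint_diff_le x y u.
have LfM_L := Lf_le_M_L hA tau1_gt0 Lcheck_gt0 Lcheck_le mu0.
have LGM := LG_M_B_le_M_L hA hbase hB Lcheck_gt0 Lcheck_le mm0.
move: (adjoint (DG D y) u) (adjoint (DG D x) u) (grad (objf D) y)
  (grad (objf D) x) (y - x) h1 h2 => a' a q p d h1 h2.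
have -> : - (p - xi + Lf' *: d + lam *: (a + (Lg' / mu) *: d)) - xi + q + lam *: a'
    = (q - p) - Lf' *: d + lam *: (a' - a) - (lam * (Lg' / mu)) *: d.
  by apply: dotp_inj => z; rewrite !dotpE; ring.
apply: le_trans (ler_normB _ _) _; rewrite normrZ ger0_norm; last first.
  by rewrite mulr_ge0// divr_ge0// ltW.
have := ler_normD (q - p - Lf' *: d) (lam *: (a' - a)).
have := ler_normB (q - p) (Lf' *: d); rewrite !normrZ !ger0_norm// => h3 h4.
have d0 : 0 <= `|d| by [].
have h5 : lam * `|a' - a| <= lam / mu * M_L D mu0 * `|d|.
  have -> : lam / mu * M_L D mu0 * `|d| = lam * (M_L D mu0 / mu * `|d|).
    by field; rewrite gt_eqF.
  rewrite ler_wpM2l// (le_trans h2)// mulrAC ler_wpM2r// ler_pdivlMr// mulrC.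
  by apply: le_trans LGM; rewrite ler_wpM2l ?(ltW m)// ler_wpM2l// (LG_ge0 hA).
have h6 : lam * (Lg' / mu) * `|d| <= lam / mu * M_L D mu0 * `|d|.
  by rewrite ler_wpM2r// mulrA mulrAC ler_wpM2l// divr_ge0// ltW.
have h7 : Lf D * `|d| <= M_L D mu0 * `|d| by rewrite ler_wpM2r.
have h8 : Lf' * `|d| <= M_L D mu0 * `|d| by rewrite ler_wpM2r.
have -> : 2 * M_L D mu0 * (1 + lam / mu) * `|d| =
    2 * (M_L D mu0 * `|d|) + 2 * (lam / mu * M_L D mu0 * `|d|) by ring.
by lra.
Qed.

(** Convexity bounds [- '[u, G x]] by [alpha3 * mu - gmu x], the curvature bound of [G] moves this
    to [y], and complementarity trades [lam] times the linearized constraint for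
    [- lam * Lg' / (2 * mu) * |y - x| ^ 2]. *)
Lemma KKT_complementarity_le (mu0 mu : R) x (Lg' : R) y lam :
  0 < mu <= mu0 -> 0 <= lam -> 0 <= Lg' <= M_L D mu0 ->
  lam * g_model D mu x Lg' y = 0 ->
  - '[lam *: grad (hmu D mu) (conG D x), conG D y] <=
    lam * (alpha3 D * mu)
    + lam / mu * ((M_L D mu0 + mu0 * LG D * M_B D) / 2) * `|y - x| ^+ 2.
Proof.
move=> /andP[m m0] lam0 /andP[Lg0 LgM]; rewrite /g_model => compl.
set u := grad _ _; have uM : `|u| <= M_B D by exact/(norm_le_M_B
  hbase)/grad_hmu_baseB.
have := smooth_dotp_descent x y (- u) (smooth_conG hA).
have := hmu_le_dotp_grad hbase hB (conG D x) m.
have gE : '[grad (gmu D mu) x, y - x] = '[u, DG D x (y - x)] by exact: grad_gmuE.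
rewrite gE -/(gmu D mu x) -/u in compl *.
rewrite normrN !dotpNl dotpZl.
have : `|u| * LG D * `|y - x| ^+ 2 <= M_B D * LG D * `|y - x| ^+ 2.
  by rewrite ler_wpM2r ?sqr_ge0// ler_wpM2r// (LG_ge0 hA).
have n0 : 0 <= `|y - x| ^+ 2 by exact: sqr_ge0.
rewrite -/(DG D x); move: '[u, DG D x (y - x)] '[u, conG D x] '[u, conG D y]
  (`|y - x| ^+ 2) n0 compl => p q s n n0 compl h1 h2 h3.
have h4 : - s <= alpha3 D * mu - (gmu D mu x + p) + M_B D * LG D * n / 2 by lra.
have h5 : lam * - s <= lam * (alpha3 D * mu - (gmu D mu x + p) + M_B D * LG D * n
  / 2).
  by rewrite ler_wpM2l.
have h6 : lam / mu * (mu * (M_B D * LG D) * n) <= lam / mu * (mu0 * (M_B D * LG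
  D) * n).
  rewrite ler_wpM2l ?divr_ge0// ?(ltW m)// ler_wpM2r// ler_wpM2r//.
  by rewrite mulr_ge0 ?(M_B_ge0 hbase) ?(LG_ge0 hA).
have h7 : lam / mu * (mu * (M_B D * LG D) * n) = lam * (M_B D * LG D * n).
  by field; rewrite gt_eqF.
have h8 : lam / mu * (Lg' * n) <= lam / mu * (M_L D mu0 * n).
  by rewrite ler_wpM2l ?divr_ge0// ?(ltW m)// ler_wpM2r.
have h9 : lam * (gmu D mu x + p) = - (lam / mu * (Lg' * n) / 2).
  apply/eqP; rewrite -subr_eq0 opprK -compl; apply/eqP; field; rewrite gt_eqF//.
lra.
Qed.

End ApproximateKKT.

(** * The iterates *)

Section Sequence.
Context {R : realType} {X Y : finHilbertType R} (D : sMBA_data X Y).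
Context (hA : assumption_A D) (hbase : compact_base D) (hB : assumption_B D).
Context (tau1_gt0 : 0 < tau1 D) (tau2_gt0 : 0 < tau2 D).
Context (Lcheck_gt0 : 0 < Lcheck D) (Lcheck_le : Lcheck D <= Lhat D).
Context (mu : nat -> R) (x : nat -> X) (hx : sMBA_sequence D mu x).

Local Notation Omega := (Omega0 D).

Lemma mu_decreasing m n : (m < n)%N -> mu n < mu m.
Proof.
have muS k : mu k.+1 < mu k by case: hx => _ _ /(_ k)/andP[].
elim: n => // n ih; rewrite ltnS leq_eqVlt => /predU1P[->//|/ih].
exact: lt_trans.
Qed.

Lemma mu_gt0 k : 0 < mu k.
Proof. by case: k => [|k]; case: hx => _ [] // _ _ /(_ k)/andP[]. Qed.

Lemma mu_le_mu0 k : 0 < mu k <= mu 0%N.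
Proof.
rewrite mu_gt0 /=; case: k => [|k]; first exact: lexx.
by apply: ltW; exact: mu_decreasing.
Qed.

(** Forgets the trial loop: the powers of 2 survive only through the bounds by [M_L]. *)
Definition accepted_step k xi (Lf' Lg' lam : R) : Prop :=
  [/\ subdiff (P2 D) (x k) xi, 0 <= Lf' <= M_L D (mu 0%N) /\
      Lcheck D <= Lg' <= M_L D (mu 0%N),
      multiplier (psi_model D (x k) xi Lf') (g_model D (mu k) (x k) Lg')
        (x k.+1) lam,
      gmu D (mu k) (x k.+1) <= 0 &
      psi D (x k.+1) <= psi D (x k)
        - (tau1 D * mu k + tau2 D * lam) / (2 * mu k) * `|x k.+1 - x k| ^+ 2].

Lemma sMBA_accepted_step k : Omega (x k) -> gmu D (mu k) (x k) <= 0 ->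
  exists xi Lf' Lg' lam, accepted_step k xi Lf' Lg' lam.
Proof.
move=> Ox gx; case: hx => _ _ _ [xi [Lf0 [Lg0 [xt [lam [ii [jj /(_ k)]]]]]]].
move=> [xiP [Lf0P Lg0P] trial [vis feas desc] xS].
have [i j v|LfM LgM] := backtracking_le_M_L hA hbase hB Lcheck_gt0 (mu_le_mu0 k)
  Ox gx xiP Lf0P Lg0P _ vis.
  by have [[[? _] _] ?] := trial i j v.
have pow1 n : 1 <= 2 ^+ n :> R by rewrite exprn_ege1// ler1n.
have Lge n (L : R) : Lcheck D <= L -> Lcheck D <= 2 ^+ n * L.
  move=> LL; rewrite (le_trans LL)// ler_peMl//.
  exact: le_trans (ltW Lcheck_gt0) LL.
exists (xi k), (2 ^+ ii k * Lf0 k), (2 ^+ jj k * Lg0 k), (lam k (ii k) (jj k)).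
rewrite /accepted_step xS; split=> //; last by case: (trial _ _ vis).
rewrite LfM LgM !andbT; split; last by apply: Lge; case/andP: Lg0P.
by apply: le_trans (ltW Lcheck_gt0) _; apply: Lge; case/andP: Lf0P.
Qed.

(** Both claims enter one induction because [sMBA_accepted_step] asks for both at [x k]. The
    acceptance test gives only [<= 0] at the old parameter; strictness returns from the decrease of
    [mu]. *)
Lemma sMBA_iterate k : Omega (x k) /\ gmu D (mu k) (x k) < 0.
Proof.
elim: k => [|k [Ox gx]].
  by case: hx => -> [_ ?] _ _; split=> //; exact: x0_Omega0.
have [xi [Lf' [Lg' [lam [_ _ [lam0 _ _] gy desc]]]]] := sMBA_accepted_step Ox
  (ltW gx).
have m0 := mu_gt0 k; split.
  split; last exact: feasible_of_gmu_le0 gy.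
  case: Ox => /= px _; apply: le_trans (le_trans desc _) px.
  by rewrite gerBl mulr_ge0 ?sqr_ge0// divr_ge0 ?mulr_ge0 ?addr_ge0 ?mulr_ge0// ltW.
have := gmu_antitone hB (x k.+1) (mu_gt0 k.+1) (mu_decreasing (ltnSn k)).
have := mulr_gt0 (alpha4_gt0 hB) (_ : 0 < mu k - mu k.+1).
by rewrite subr_gt0 mu_decreasing// => /(_ isT); lra.
Qed.

Context (eta : R) (heta : eta_spec D eta).
Context (tbar : nat) (htbar : tbar_spec D mu eta tbar).

Lemma ratio_gt0 t : (0 < t)%N -> 0 < mu t.-1 / mu t - 1.
Proof.
case: t => // t _; rewrite subr_gt0 ltr_pdivlMr ?mu_gt0// mul1r.
exact: mu_decreasing.
Qed.

Lemma c0_gt0 : 0 < c0 mu tbar.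
Proof.
rewrite /c0 big_nat; apply: lt_bigmin; first exact: (@ratio_gt0 1).
by move=> t /andP[t0 _]; exact: ratio_gt0.
Qed.

Lemma c0_le t : (0 < t <= tbar)%N -> c0 mu tbar <= mu t.-1 / mu t - 1.
Proof.
by move=> tt; rewrite /c0; apply: ge_bigmin_seq => //; rewrite mem_index_iota ltnS.
Qed.

Let eta_min : R :=
  Num.min eta
    (Num.min (2 * alpha3 D * Lcheck D)
      (Num.min (- 2 * (mu 0%N)^-1 * Lcheck D * gmu D (mu 0%N) (x0 D))
               (2 * c0 mu tbar * alpha4 D * Lcheck D))).

(** [Num.sqrt] is 0 on negative numbers, so this positivity is what makes [eta_bar] positive and its
    square equal to the minimum. *)
Lemma eta_min_gt0 : 0 < eta_min.
Proof.
rewrite /eta_min !lt_min; apply/and4P; split.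
- by case: heta.
- by rewrite !mulr_gt0// (alpha3_gt0 hB).
- case: hx => _ [m0 g0] _ _.
  by rewrite -!mulrA mulNr oppr_gt0 pmulr_rlt0// pmulr_rlt0 ?invr_gt0// pmulr_rlt0.
- by rewrite !mulr_gt0// ?c0_gt0 ?(alpha4_gt0 hB).
Qed.

Lemma eta_bar_gt0 : 0 < eta_bar D mu eta tbar.
Proof. by rewrite sqrtr_gt0 eta_min_gt0. Qed.

(* Three ways to stay away from criticality: at [k = 0] by the choice of
   [mu 0], for [k <= tbar] because decreasing [mu] lowers [gmu], and later
   because [gmu] is then close enough to [gB] to use [eta]. *)
Lemma eta_bar_sqr_le k :
  eta_bar D mu eta tbar ^+ 2 <=
    `|grad (gmu D (mu k)) (x k)| ^+ 2 - 2 * Lcheck D / mu k * gmu D (mu k) (x k).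
Proof.
rewrite sqr_sqrtr ?(ltW eta_min_gt0)// -/eta_min.
have [Ox gx] := sMBA_iterate k; have m0 := mu_gt0 k.
have a3 := alpha3_gt0 hB.
set g2 := `|_| ^+ 2; have g20 : 0 <= g2 by exact: sqr_ge0.
have k0 : 0 < 2 * Lcheck D / mu k by rewrite divr_gt0// mulr_gt0.
(* A margin of [c] per unit of [mu k] is worth [2 * Lcheck D * c]. It is used with
   [c = c0 mu tbar * alpha4 D] and with [c = alpha3 D]. *)
have scale c : gmu D (mu k) (x k) <= - (mu k * c) ->
    2 * Lcheck D * c <= g2 - 2 * Lcheck D / mu k * gmu D (mu k) (x k).
  move=> gc; have := ler_wpM2l (ltW k0) gc.
  have -> : 2 * Lcheck D / mu k * - (mu k * c) = - (2 * Lcheck D * c).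
    by field; rewrite gt_eqF.
  by lra.
have [k00|kpos] := posnP k.
  rewrite k00 in gx g20 scale m0 *; case: hx => x00 _ _ _.
  apply: (@le_trans _ _ (- 2 * (mu 0%N)^-1 * Lcheck D * gmu D (mu 0%N) (x0 D))).
    by rewrite /eta_min !ge_min lexx !orbT.
  rewrite -x00; move: g20; rewrite -/g2; move: (gmu _ _ _) => c; lra.
have [ktbar|tbark] := leqP k tbar.
  apply: (@le_trans _ _ (2 * Lcheck D * (c0 mu tbar * alpha4 D))).
    rewrite /eta_min !ge_min; apply/orP; right; apply/orP; right; apply/orP; right.
    by rewrite le_eqVlt; apply/orP; left; apply/eqP; ring.
  apply: scale.
  have kS := prednK kpos.
  (* The acceptance test speaks of the old parameter; passing to [mu k] gains
     [alpha4 * (mu k.-1 - mu k)], at least [alpha4 * c0 * mu k]. *)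
  have gp : gmu D (mu k.-1) (x k) <= 0.
    have [Oxp gxp] := sMBA_iterate k.-1.
    have [xi [Lf' [Lg' [lam [_ _ _ + _]]]]] := sMBA_accepted_step Oxp (ltW gxp).
    by rewrite kS.
  have := gmu_antitone hB (x k) m0 (mu_decreasing (_ : (k.-1 < k)%N)).
  rewrite kS leqnn => /(_ isT) h.
  have := c0_le (t := k); rewrite kpos ktbar lerBrDr ler_pdivlMr// => /(_ isT) hc.
  by have := alpha4_gt0 hB; nra.
have mk : mu k < eta / (2 * alpha3 D).
  by case: htbar => _ h _; apply: lt_trans h; exact: mu_decreasing.
rewrite ltr_pdivlMr ?mulr_gt0// in mk.
set u := grad (hmu D (mu k)) (conG D (x k)).
have Bu : baseB D u by exact: grad_hmu_baseB.
have gE : grad (gmu D (mu k)) (x k) = adjoint (DG D (x k)) u by exact: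
  grad_gmu_adjoint.
case: heta => _ /(_ _ _ Ox Bu) eta_alt.
have [small|large] := leP (`|adjoint (DG D (x k)) u| ^+ 2) eta; last first.
  apply: (@le_trans _ _ eta); first by rewrite /eta_min ge_min lexx.
  rewrite (le_trans (ltW large))// /g2 gE lerDl oppr_ge0 pmulr_rle0// ltW//.
(* As [2 * alpha3 * mu k < eta] beyond [tbar], the smoothing error [alpha3 * mu k] uses up less than
   half of this margin. *)
have large : eta < - '[u, conG D (x k)].
  by rewrite ltNge; apply/negP => h; apply: eta_alt.
apply: (@le_trans _ _ (2 * Lcheck D * alpha3 D)).
  rewrite /eta_min !ge_min; apply/orP; right; apply/orP; left.
  by rewrite mulrAC.
apply: scale.
have := hmu_le_dotp_grad hbase hB (conG D (x k)) m0; rewrite -/u -/(gmu _ _ _).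
by lra.
Qed.

Lemma sMBA_multiplier_le k xi Lf' Lg' lam : accepted_step k xi Lf' Lg' lam ->
  lam <= M_lambda D mu eta tbar.
Proof.
move=> [xiP [LfM /andP[LgL _]] mult _ _].
have [Ox gx] := sMBA_iterate k; have [Oy _] := sMBA_iterate k.+1.
exact: (multiplier_le hA hbase hB tau1_gt0 Lcheck_gt0 Lcheck_le (mu_le_mu0 k) Ox Oy
  (ltW gx) xiP LfM LgL eta_bar_gt0 (eta_bar_sqr_le k) mult).
Qed.

End Sequence.

(** * Rates *)

Section Rates.
Context {R : realType}.

Lemma exists_le_average (a : nat -> R) (c : R) (m n : nat) : (m <= n)%N ->
  a m - a n.+1 <= (n.+1 - m)%:R * c ->
  exists2 k, (m <= k <= n)%N & a k - a k.+1 <= c.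
Proof.
move=> mn total.
have [//|none] := pselect (exists2 k, (m <= k <= n)%N & a k - a k.+1 <= c).
have : \sum_(m <= k < n.+1) c < \sum_(m <= k < n.+1) (a k - a k.+1).
  apply: ltr_sum_nat => [|k]; first by rewrite ltnS.
  by rewrite ltnS => mk; rewrite ltNge; apply/negP => h; apply: none; exists k.
rewrite sumr_const_nat -mulr_natl.
have -> : \sum_(m <= k < n.+1) (a k - a k.+1) = a m - a n.+1.
  rewrite -opprB -(telescope_sumr a (leqW mn)) -sumrN.
  by apply: eq_bigr => k _; rewrite opprB.
by lra.
Qed.

Lemma powR_le_of_root_le (A e k q : R) : 0 <= A -> 0 < e -> 0 < q ->
  A `^ (1 / q) * e `^ (- (2 / q)) <= k -> A <= e ^+ 2 * k `^ q.
Proof.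
move=> A0 e0 q0 hk; have q1 := lt0r_neq0 q0.
have := ge0_ler_powR (ltW q0) _ _ hk.
rewrite !nnegrE mulr_ge0 ?powR_ge0// (le_trans _ hk) ?mulr_ge0 ?powR_ge0//.
move=> /(_ isT isT); rewrite powRM ?powR_ge0// -!powRrM mulNr !divfK//.
rewrite powRr1// powRN (powR_mulrn _ (ltW e0)) => h.
by rewrite [leRHS]mulrC -ler_pdivrMr ?exprn_gt0.
Qed.

Lemma powR_le_of_inv_root_le (m Q e k r : R) : 0 < r -> 0 < m -> 0 < Q -> 0 < e ->
  2 * m `^ (1 / r) * Q `^ (- (1 / r)) * e `^ (- (1 / r)) <= k ->
  2 `^ r * m <= Q * e * k `^ r.
Proof.
move=> r0 m0 Q0 e0 hk; have r1 := lt0r_neq0 r0.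
have l0 : 0 <= 2 * m `^ (1 / r) * Q `^ (- (1 / r)) * e `^ (- (1 / r)).
  by rewrite !mulr_ge0 ?powR_ge0.
have := ge0_ler_powR (ltW r0) _ _ hk.
rewrite !nnegrE l0 (le_trans l0 hk) => /(_ isT isT).
rewrite !powRM ?mulr_ge0 ?powR_ge0// -!powRrM mulNr !divfK//.
rewrite !powRN !powRr1 ?(ltW m0) ?(ltW Q0) ?(ltW e0)// => h.
by rewrite [leRHS]mulrC -ler_pdivrMr ?mulr_gt0// invfM mulrA.
Qed.

Lemma two_powR (r : R) : 2 `^ (2 * r + 1) = 2 * (2 `^ r) ^+ 2.
Proof.
rewrite powRD; last by rewrite pnatr_eq0 implybT.
by rewrite powRr1// [2 * r]mulrC powRrM powR_mulrn ?powR_ge0// mulrC.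
Qed.

Lemma one_le_two_powR (r : R) : 0 <= r -> 1 <= 2 `^ r.
Proof. by move=> r0; rewrite -[leLHS](powRr0 2) ler_powR// ler1n. Qed.

(* [w = mu0 / p] with [p = k ^ r]; the average decrease is at most [e1 ^ 2 w / b1]. *)
Lemma rate_arithmetic (mu0 mu T p k d b1 b2 l a3 t1 e1 e2 Q : R) :
  0 < mu0 -> 0 < mu -> 1 <= T -> 0 < p -> 0 < k -> 0 <= d -> 0 < b1 -> 0 < b2 ->
  0 <= l -> 0 < a3 -> 0 < t1 -> 0 < e1 -> 0 < e2 ->
  b1 * d * (2 * T ^+ 2) / mu0 <= e1 ^+ 2 * (k / p) ->
  T * mu0 <= Q * e2 * p ->
  Q <= b1 / (a3 * b1 * l + b2 * e1 ^+ 2) -> Q <= t1 * b1 / 2 ->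
  mu0 * k <= mu * p * (k + 1) -> mu * p <= T * mu0 ->
  [/\ b1 / mu * (2 * d / (k + 1)) <= e1 ^+ 2,
      2 / t1 * (2 * d / (k + 1)) <= e1 ^+ 2 * e2 &
      l * (a3 * mu) + b2 * (2 * d / (k + 1)) <= e2].
Proof.
move=> mu0_gt0 mu_gt0 T1 p0 k0 d0 b10 b20 l0 a30 t10 e10 e20 H1 H2 Q1 Q2 Hmu1 Hmu2.
have e12 : 0 < e1 ^+ 2 by rewrite exprn_gt0.
have T2 : 1 <= T ^+ 2 by rewrite exprn_ege1.
pose w := mu0 / p; have w0 : 0 < w by rewrite divr_gt0.
have wp : w * p = mu0 by rewrite /w divfK// gt_eqF.
have dk : b1 * (2 * d) <= e1 ^+ 2 * (k * w).
  move: H1; rewrite ler_pdivrMr// => H1.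
  have -> : e1 ^+ 2 * (k * w) = e1 ^+ 2 * (k / p) * mu0 by rewrite /w; ring.
  apply: le_trans H1; have : b1 * (2 * d) * 1 <= b1 * (2 * d) * T ^+ 2.
    by rewrite ler_wpM2l// !mulr_ge0// ltW.
  by lra.
have k1 : 0 < k + 1 by rewrite addr_gt0.
set c := 2 * d / (k + 1).
have ck : c * (k + 1) = 2 * d by rewrite /c divfK// gt_eqF.
have c0 : 0 <= c by rewrite /c divr_ge0 ?mulr_ge0// ltW.
have kw : k * w <= mu * (k + 1).
  rewrite -(ler_pM2r p0); apply: le_trans (_ : mu0 * k <= _); last by lra.
  by rewrite -wp; lra.
have bc : b1 * c <= e1 ^+ 2 * w.
  have h : b1 * c * k <= e1 ^+ 2 * w * k.
    have : 0 <= b1 * c by rewrite mulr_ge0// ltW.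
    have -> : e1 ^+ 2 * w * k = e1 ^+ 2 * (k * w) by ring.
    move: dk; rewrite -ck; lra.
  by rewrite -(ler_pM2r k0).
have wTQ : T * w <= Q * e2.
  rewrite -(ler_pM2r p0); apply: le_trans H2; rewrite -wp; lra.
have wT : w <= T * w by rewrite ler_peMl// ltW.
split.
- rewrite mulrAC ler_pdivrMr//.
  have h : b1 * c * (k + 1) <= e1 ^+ 2 * mu * (k + 1).
    rewrite -mulrA ck; apply: le_trans dk _; rewrite -mulrA.
    by rewrite ler_wpM2l// ltW.
  by rewrite -(ler_pM2r k1).
- rewrite mulrAC ler_pdivrMr// -(ler_pM2r b10).
  have h : e1 ^+ 2 * w <= e1 ^+ 2 * (t1 * b1 / 2 * e2).
    rewrite ler_wpM2l ?(ltW e12)// (le_trans wT)// (le_trans wTQ)//.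
    by rewrite ler_wpM2r// ltW.
  by lra.
(* Multiplied by [b1], the two summands of the gap are at most [T * w] times the two terms of this
   denominator, and [T * w <= Q * e2]. *)
- have den : 0 < a3 * b1 * l + b2 * e1 ^+ 2.
    by rewrite ltr_wpDl ?mulr_gt0// !mulr_ge0// ltW.
  rewrite -(ler_pM2r b10); move: Q1; rewrite ler_pdivlMr// => Q1.
  have h1 : l * a3 * mu * b1 <= l * a3 * (T * w) * b1.
    rewrite ler_wpM2r ?(ltW b10)// ler_wpM2l ?mulr_ge0 ?(ltW a30)//.
    by rewrite -(ler_pM2r p0); apply: le_trans Hmu2 _; rewrite -wp; lra.
  have h2 : b2 * (b1 * c) <= b2 * (e1 ^+ 2 * (T * w)).
    rewrite ler_wpM2l ?(ltW b20)// (le_trans bc)// ler_wpM2l// ltW//.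
  have h3 : (T * w) * (a3 * b1 * l + b2 * e1 ^+ 2) <= e2 * b1.
    apply: le_trans (ler_wpM2r (ltW den) wTQ) _.
    have := ler_wpM2l (ltW e20) Q1; lra.
  by lra.
Qed.

(* [(1 + q) ^ 2 <= 2 (1 + q ^ 2)] with [q = lam / mu], each term being paid for
   by one of the two summands of the decrease. *)
Lemma residual_sqr_le (L m t1 t2 mu0 mu lam l n : R) :
  0 < t1 -> 0 < t2 -> 0 < mu <= mu0 -> 0 <= lam <= l -> 0 <= n ->
  mu0 / t1 <= m -> l / t2 <= m ->
  (2 * L * (1 + lam / mu)) ^+ 2 * n <=
  16 * L ^+ 2 * m / mu * ((t1 * mu + t2 * lam) / (2 * mu) * n).
Proof.
move=> t10 t20 /andP[mu_gt0 mu_le] /andP[lam0 lam_le] n0.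
rewrite !ler_pdivrMr// => m1 m2.
pose q := lam / mu; have q0 : 0 <= q by rewrite divr_ge0// ltW.
have qmu : q * mu = lam by rewrite /q divfK// gt_eqF.
have mu1 : mu * mu^-1 = 1 by rewrite divff// gt_eqF.
have -> : 16 * L ^+ 2 * m / mu * ((t1 * mu + t2 * lam) / (2 * mu) * n) =
   8 * (L ^+ 2 * n) * (m / mu * (t1 + t2 * q)).
  by rewrite -qmu; field; rewrite gt_eqF.
rewrite -/q; have -> : (2 * L * (1 + q)) ^+ 2 * n = 4 * (L ^+ 2 * n) * (1 + q) ^+
  2 by ring.
have h1 : 1 <= m / mu * t1.
  by rewrite mulrAC ler_pdivlMr// mul1r (le_trans mu_le).
have h2 : q ^+ 2 <= m / mu * (t2 * q).
  rewrite expr2 mulrA ler_wpM2r// mulrAC ler_pdivlMr// qmu.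
  exact: le_trans lam_le m2.
have : 0 <= L ^+ 2 * n by rewrite mulr_ge0 ?sqr_ge0.
move: (L ^+ 2 * n) (m / mu) h1 h2 => z y h1 h2 z0.
have h3 : (1 + q) ^+ 2 <= 2 * (y * (t1 + t2 * q)).
  by have := sqr_ge0 (1 - q); lra.
by have := ler_wpM2l z0 h3; lra.
Qed.

End Rates.

(** * Choice of the index and verification of the three tolerances *)

Lemma edist_inf_le_norm (R : realType) (V : normedModType R) (A : set V) (a : V)
  (e : R) :
  A a -> `|a| <= e -> (edist_inf A 0%R <= e%:E)%E.
Proof.
move=> Aa ae; apply/lee_addgt0Pr => d d0; rewrite -EFinD.
have e0 : 0 <= e by exact: le_trans ae.
apply: ereal_inf_le; exists (edist (0, a)); first by exists a.
apply: edist_fin; first by rewrite ltr_wpDl.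
by rewrite /= -ball_normE /= sub0r normrN (le_lt_trans ae)// ltrDl.
Qed.

Theorem corollary3p10 (R : realType) (X Y : finHilbertType R)
    (D : sMBA_data X Y)
    (hA : assumption_A D) (hbase : compact_base D) (hB : assumption_B D)
    (htau1 : 0 < tau1 D) (htau2 : 0 < tau2 D)
    (hLcheck : 0 < Lcheck D) (hLhat : Lcheck D <= Lhat D)
    (r : R) (hr : 0 < r < 1)
    (mu : nat -> R) (hmu0 : 0 < mu 0%N)
    (hmuk : forall k, (0 < k)%N -> mu k = mu 0%N * k.+1%:R `^ (- r))
    (eta : R) (heta : eta_spec D eta)
    (tbar : nat) (htbar : tbar_spec D mu eta tbar)
    (x : nat -> X) (hx : sMBA_sequence D mu x)
    (eps1 eps2 : R) (heps1 : 0 < eps1) (heps2 : 0 < eps2)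
    (K : nat)
    (hK : Num.max
            ((M_bar1 D mu eta tbar * (psi D (x0 D) - psi_star D)
              * 2 `^ (2 * r + 1) / mu 0%N) `^ (1 / (1 - r))
             * eps1 `^ (- (2 / (1 - r))))
            (2 * mu 0%N `^ (1 / r)
             * (Num.min
                  (M_bar1 D mu eta tbar
                   / (alpha3 D * M_bar1 D mu eta tbar * M_lambda D mu eta tbar
                      + M_bar2 D mu * eps1 ^+ 2))
                  (tau1 D * M_bar1 D mu eta tbar / 2)) `^ (- (1 / r))
             * eps2 `^ (- (1 / r)))
          <= K%:R) :
  exists khat : nat,
    (uphalf K <= khat <= K)%N /\
    is_KKT D eps1 eps2 (eps1 * Num.sqrt eps2) (x khat.+1).

Proof.
have /andP[r0 r1] := hr.
have Or := sMBA_iterate hA hbase hB htau1 htau2 hLcheck hx.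
have ML0 := M_L_gt0 hA htau1 hLcheck hLhat (mu 0%N).
set b1 := M_bar1 D mu eta tbar in hK *; set b2 := M_bar2 D mu in hK *.
set l := M_lambda D mu eta tbar in hK *.
have b1E : b1 = 16 * M_L D (mu 0%N) ^+ 2 * Num.max (mu 0%N / tau1 D) (l / tau2 D)
  by [].
have b2E : b2 = (M_L D (mu 0%N) + mu 0%N * LG D * M_B D) / tau2 D by [].
have lE : l = M_lambda D mu eta tbar by [].
clearbody b1 b2 l.
set Q := Num.min _ _ in hK; set Delta := psi D (x0 D) - psi_star D in hK.
(* Read off from the first step, whose multiplier is nonnegative and at most [l], rather than from
   the signs of the suprema in [M_lambda]. *)
have l0 : 0 <= l.
  have [Ox gx] := Or 0%N.
  have [xi [Lf' [Lg' [lam st]]]] :=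
    sMBA_accepted_step hA hbase hB hLcheck hx Ox (ltW gx).
  rewrite lE; apply: le_trans (sMBA_multiplier_le hA hbase hB htau1 htau2 hLcheck
    hLhat hx heta htbar st).
  by case: st => _ _ [].
have b1_gt0 : 0 < b1.
  rewrite b1E mulr_gt0//; first by rewrite mulr_gt0 ?exprn_gt0.
  by rewrite lt_max divr_gt0.
have b2_gt0 : 0 < b2.
  rewrite b2E divr_gt0// ltr_wpDr//.
  by rewrite !mulr_ge0 ?(LG_ge0 hA) ?(M_B_ge0 hbase)// ltW.
have a3 := alpha3_gt0 hB.
have e12 : 0 < eps1 ^+ 2 by rewrite exprn_gt0.
have Q0 : 0 < Q.
  rewrite /Q lt_min; apply/andP; split; last by rewrite divr_gt0 ?mulr_gt0.
  by rewrite divr_gt0// ltr_wpDl ?mulr_gt0// !mulr_ge0// ltW.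
have [Q1 Q2] : Q <= b1 / (alpha3 D * b1 * l + b2 * eps1 ^+ 2) /\ Q <= tau1 D * b1
  / 2.
  by apply/andP; rewrite -le_min.
clearbody Q; have Delta0 : 0 <= Delta.
  by rewrite subr_ge0 (psi_star_le hA)//; case: (x0_Omega0 hA).
move: hK; rewrite ge_max => /andP[hK1 hK2].
(* The second lower bound is a product of positive powers, which excludes [K = 0]. *)
have K0 : 0 < K%:R :> R by apply: lt_le_trans hK2; rewrite !mulr_gt0 ?powR_gt0.
have r1' : 0 < 1 - r by rewrite subr_gt0.
have H1 := powR_le_of_root_le _ heps1 r1' hK1.
have H2 := powR_le_of_inv_root_le r0 hmu0 Q0 heps2 hK2.
set p := K%:R `^ r in H2; have p0 : 0 < p by rewrite powR_gt0.
set T := 2 `^ r in H2.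
have T1 : 1 <= T by apply: one_le_two_powR; exact: ltW.
have K1r : K%:R `^ (1 - r) = K%:R / p.
  rewrite powRB; last by rewrite (gt_eqF K0) implybT.
  by rewrite powRr1// ltW.
have muE k : mu k = mu 0%N * k.+1%:R `^ (- r).
  by case: k => [|k]; [rewrite powR1 mulr1|exact: hmuk].
pose c := 2 * Delta / (K%:R + 1).
have uK : (uphalf K <= K)%N by rewrite uphalf_half -{3}(odd_double_half K)
  leq_add2l -addnn leq_addr.
have [|k kK kc] := @exists_le_average _ (fun k => psi D (x k)) c _ _ uK.
  have [[_ f1] [h1 _]] : Omega0 D (x K.+1) /\ Omega0 D (x (uphalf K)).
    by split; [case: (Or K.+1)|case: (Or (uphalf K))].
  apply: (@le_trans _ _ Delta); first by rewrite lerB// (psi_star_le hA).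
  (* The window has [K./2.+1] indices, at least half of [K + 1]. *)
  have half : (K%:R + 1 : R) <= 2 * (K.+1 - uphalf K)%:R.
    rewrite natr1 -natrM ler_nat mul2n uphalf_half.
    have -> : (K.+1 - (odd K + K./2) = K./2.+1)%N.
      by rewrite -{1}(odd_double_half K) -addnn addnA -addnS addKn.
    rewrite doubleS -{1}(odd_double_half K) -addSn -addn2 addnC leq_add2l.
    by case: odd.
  have K10 : 0 < K%:R + 1 :> R by rewrite addr_gt0.
  rewrite /c mulrA ler_pdivlMr//; have := ler_wpM2l Delta0 half; lra.
have [Ox gx] := Or k; have [Oy _] := Or k.+1.
have [xi [Lf' [Lg' [lam st]]]] :=
  sMBA_accepted_step hA hbase hB hLcheck hx Ox (ltW gx).
have lam_l := sMBA_multiplier_le hA hbase hB htau1 htau2 hLcheck hLhat hx heta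
  htbar st.
rewrite -lE in lam_l; case: st => xiP [LfM LgM] mult gy desc.
have /andP[LgL LgM_L] := LgM.
have Lg0M : 0 <= Lg' <= M_L D (mu 0%N) by rewrite LgM_L (le_trans (ltW hLcheck)).
have mk := mu_le_mu0 hx k; have /andP[m0 _] := mk.
have [lam0 compl _] := mult.
have k1 : 0 < k.+1%:R :> R by rewrite ltr0n.
have [kl ku] : (uphalf K <= k)%N /\ (k <= K)%N by apply/andP.
have mukE : mu k = mu 0%N / k.+1%:R `^ r by rewrite muE powRN.
have kr0 : 0 < k.+1%:R `^ r :> R by rewrite powR_gt0.
(* The index shift in [mu] can make [mu k] as small as [mu0 * (K + 1) ^ (- r)], below [mu0 / p]. The
   [K + 1] in the average makes up for it, because [K ^ (1 - r) <= (K + 1) ^ (1 - r)]. *)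
have Hmu1 : mu 0%N * K%:R <= mu k * p * (K%:R + 1).
  have K10 : 0 < K%:R + 1 :> R by rewrite addr_gt0.
  set p1 := (K%:R + 1) `^ r; have p10 : 0 < p1 by rewrite powR_gt0.
  have krp1 : k.+1%:R `^ r <= p1.
    by rewrite ge0_ler_powR ?nnegrE ?(ltW r0) ?(ltW K10)// natr1 ler_nat.
  have Kp1 : K%:R * p1 <= p * (K%:R + 1).
    have -> : K%:R * p1 = K%:R `^ (1 - r) * (p * p1).
      by rewrite K1r mulrA divfK// gt_eqF.
    have -> : p * (K%:R + 1) = (K%:R + 1) `^ (1 - r) * (p * p1).
      rewrite powRB; last by rewrite (gt_eqF K10) implybT.
      by rewrite (powRr1 (ltW K10)) -/p1; field; rewrite gt_eqF.
    rewrite ler_wpM2r ?mulr_ge0 ?(ltW p0) ?(ltW p10)// ge0_ler_powR ?nnegrE ?(ltW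
      r1') ?(ltW K10) ?(ltW K0)//.
    by rewrite lerDl.
  rewrite mukE -!mulrA ler_wpM2l ?(ltW hmu0)// mulrC ler_pdivlMr//.
  by rewrite (le_trans _ Kp1)// ler_wpM2l// ltW.
(* Here the restriction to [k >= uphalf K] pays off: [K <= 2 * k.+1], whence the factor [2 ^ r]. *)
have Hmu2 : mu k * p <= T * mu 0%N.
  rewrite mukE mulrAC ler_pdivrMr// mulrAC [leRHS]mulrC ler_wpM2l ?(ltW hmu0)//.
  rewrite -powRM ?ler0n// ge0_ler_powR ?nnegrE ?(ltW r0) ?mulr_ge0 ?ler0n//.
  rewrite -natrM ler_nat (leq_trans (_ : K <= 2 * uphalf K)%N)//.
    rewrite uphalf_half -{1}(odd_double_half K) mulnDr mul2n -(mul2n K./2).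
    by rewrite leq_add2r -addnn leq_addr.
  by rewrite leq_mul2l ltnW.
have [] := @rate_arithmetic R (mu 0%N) (mu k) T p K%:R Delta b1 b2 l
  (alpha3 D) (tau1 D) eps1 eps2 Q hmu0 m0 T1 p0 K0 Delta0 b1_gt0 b2_gt0 l0 a3
  htau1 heps1 heps2 _ H2 Q1 Q2 Hmu1 Hmu2.
  by rewrite -K1r -two_powR; apply: H1;
    rewrite divr_ge0 ?mulr_ge0 ?powR_ge0 ?(ltW b1_gt0) ?(ltW hmu0).
rewrite -/c => B1 B2 B3.
set n2 := `|x k.+1 - x k| ^+ 2 in desc; have n20 : 0 <= n2 by exact: sqr_ge0.
have Sc : (tau1 D * mu k + tau2 D * lam) / (2 * mu k) * n2 <= c.
  by move: desc kc; rewrite /n2; lra.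
(* Both summands are nonnegative, so each alone is at most [c]: the [tau1] part controls the step
   length, the [tau2] part the complementarity gap. *)
have SE : (tau1 D * mu k + tau2 D * lam) / (2 * mu k) * n2
    = tau1 D / 2 * n2 + tau2 D / 2 * (lam / mu k * n2).
  by field; rewrite gt_eqF.
have lamn0 : 0 <= lam / mu k * n2 by rewrite mulr_ge0 ?divr_ge0 ?(ltW m0).
have t1n : 0 <= tau1 D / 2 * n2 by rewrite mulr_ge0// divr_ge0// ltW.
have t2n : 0 <= tau2 D / 2 * (lam / mu k * n2) by rewrite mulr_ge0// divr_ge0// ltW.
exists k; split=> //; split; first by case: Oy.
exists (x k), (lam *: grad (hmu D (mu k)) (conG D (x k))); split.
- by case: Ox.
- by apply: polarZ => //; apply: baseB_polar => //; exact: grad_hmu_baseB.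
- apply: edist_inf_le_norm.
    exists (- (grad (objf D) (x k) - xi + Lf' *: (x k.+1 - x k)
       + lam *: (grad (gmu D (mu k)) (x k) + (Lg' / mu k) *: (x k.+1 - x k)))).
      exact: (multiplier_subdiff hA m0 mult).
    by exists xi.
  apply: le_trans (KKT_residual_le hA hbase hB htau1 hLcheck hLhat (x k) xi (x
    k.+1) mk lam0 LfM Lg0M) _.
  rewrite -(@ler_pXn2r _ 2) ?nnegrE ?(ltW heps1)//; last first.
    have q0 : 0 <= 1 + lam / mu k by rewrite addr_ge0 ?divr_ge0 ?(ltW m0).
    by rewrite mulr_ge0// mulr_ge0// mulr_ge0// ltW.
  apply: le_trans B1; rewrite exprMn -/n2.
  apply: le_trans (residual_sqr_le (M_L D (mu 0%N))
    (m := Num.max (mu 0%N / tau1 D) (l / tau2 D)) htau1 htau2 mk _ n20 _ _) _.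
  + by rewrite lam0; exact: lam_l.
  + by rewrite le_max lexx.
  + by rewrite le_max lexx orbT.
  by rewrite -b1E ler_wpM2l// divr_ge0 ?(ltW b1_gt0) ?(ltW m0).
- apply: le_trans (KKT_complementarity_le hA hbase hB mk lam0 Lg0M compl) _.
  apply: le_trans B3; rewrite -/n2; apply: lerD.
    by rewrite ler_wpM2r// mulr_ge0 ?(ltW a3) ?(ltW m0).
  have -> : lam / mu k * ((M_L D (mu 0%N) + mu 0%N * LG D * M_B D) / 2) * n2
      = b2 * (tau2 D / 2 * (lam / mu k * n2)).
    by rewrite b2E; field; rewrite !gt_eqF.
  by rewrite ler_wpM2l ?(ltW b2_gt0)//; move: Sc; rewrite SE; lra.
rewrite -(@ler_pXn2r _ 2) ?nnegrE ?mulr_ge0 ?sqrtr_ge0 ?(ltW heps1)//.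
rewrite exprMn sqr_sqrtr ?(ltW heps2)// (le_trans _ B2)// -/n2.
rewrite mulrC mulrA ler_pdivlMr//; move: Sc; rewrite SE; lra.
Qed.
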